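(* Let $m,n\ge1$ be integers. Suppose that $0\le\alpha<mn$, $1<p_1,\dots,p_m<\infty$, $\frac1{p_1}+\cdots+\frac1{p_m}=\frac1p$ and $p\le q<\infty$. Then there is a constant $C=C_{m,n,\vec P,q}$, depending only on $m,n,\vec P=(p_1,\dots,p_m)$ and $q$, such that the following holds. If $(u,\vec w)=(u,w_1,\dots,w_m)$ is an $(m+1)$-tuple of weights satisfying $\sigma_i=w_i^{-p_i'}\in A_\infty$ for all $i=1,\dots,m$ and $[u,\vec w]_{A_{\vec P,q}}<\infty$, then for all $f_i\in L^{p_i}(w_i^{p_i})$, $i=1,\dots,m$, $$\|\mathcal M_\alpha(\vec f)\|_{L^q(u)}\le C\left([u,\vec w]_{A_{\vec P,q}}\prod_{i=1}^m[\sigma_i]_{A_\infty}^{\frac pq\frac1{p_i}}\right)\prod_{i=1}^m\|f_i\|_{L^{p_i}(w_i^{p_i})}.$$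
   Context: $p'$ denotes the conjugate exponent, $1/p+1/p'=1$. Cubes are cubes in $\mathbb R^n$ with sides parallel to the axes; $|Q|$ is Lebesgue measure. A weight is a non-negative locally integrable function on $\mathbb R^n$ (the $w_i$ being positive a.e., so that negative powers make sense). For a weight $v$ and $s>0$, $\|f\|_{L^s(v)}=(\int_{\mathbb R^n}|f|^s v\,dx)^{1/s}$. For an $(m+1)$-tuple of weights $(u,w_1,\dots,w_m)=(u,\vec w)$ (here $u$ need not be related to $\vec w$), with $\sigma_i=w_i^{-p_i'}$, define $$[u,\vec w]_{A_{\vec P,q}}=\sup_Q|Q|^{\frac{\alpha}{n}+\frac1q-\frac1p}\left(\frac1{|Q|}\int_Q u\right)^{1/q}\prod_{i=1}^m\left(\frac1{|Q|}\int_Q\sigma_i\right)^{1/p_i'},$$ the supremum being over all cubes $Q$. For a weight $w$, with $w(Q)=\int_Q w$, $$[w]_{A_\infty}:=\sup_Q\frac1{w(Q)}\int_Q M(w\chi_Q)\,dx,$$ where $Mf(x)=\sup_{Q\ni x}\frac1{|Q|}\int_Q|f|$ is the Hardy–Littlewood maximal operator; $w\in A_\infty$ means that $w$ is a weight with $[w]_{A_\infty}<\infty$. For $\vec f=(f_1,\dots,f_m)$ the multilinear fractional maximal function is $$\mathcal M_\alpha(\vec f)(x)=\sup_{Q\ni x}\prod_{i=1}^m\frac1{|Q|^{1-\alpha/(mn)}}\int_Q|f_i(y_i)|\,dy_i,$$ the supremum being over all cubes $Q$ containing $x$. *)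

(* Defs.v *)
From HB Require Import structures.
From mathcomp Require Import all_boot all_order all_algebra.
From mathcomp Require Import all_classical all_reals all_analysis.
Import Order.TTheory GRing.Theory Num.Theory.
Import numFieldNormedType.Exports.

Set Implicit Arguments.
Unset Strict Implicit.
Unset Printing Implicit Defensive.

Local Open Scope classical_set_scope.
Local Open Scope ring_scope.

(* The Borel-Lebesgue measure on n-tuples of reals, by recursion on n: the
   image of lebesgue_measure \x (the measure in dimension n) under
   (t, x) |-> t :: x, starting from the unit mass on the point R^0. *)
Section borel_lebesgue.
Context {R : realType}.
Local Open Scope ereal_scope.
Local Notation tupleR n := (n.-tuple (measurableTypeR R)).

Definition tuple_cons n (z : measurableTypeR R * tupleR n) : tupleR n.+1 :=
  [the n.+1.-tuple _ of z.1 :: z.2].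

Lemma measurable_tuple_cons n : measurable_fun setT (@tuple_cons n).
Proof. exact: measurable_cons. Qed.

Section step.
Context n (m : {sigma_finite_measure set (tupleR n) -> \bar R}).

Definition borel_lebesgueS : set (tupleR n.+1) -> \bar R :=
  pushforward ((@lebesgue_measure R) \x m) (@tuple_cons n).

Let measurable_preimage (A : set (tupleR n.+1)) :
  measurable A -> measurable (@tuple_cons n @^-1` A).
Proof. by move=> mA; rewrite -[X in measurable X]setTI; exact: measurable_tuple_cons. Qed.

Let borel_lebesgueS0 : borel_lebesgueS set0 = 0.
Proof. by rewrite /borel_lebesgueS /pushforward preimage_set0 measure0. Qed.

Let borel_lebesgueS_ge0 A : 0 <= borel_lebesgueS A.
Proof. by rewrite /borel_lebesgueS /pushforward measure_ge0. Qed.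

Let borel_lebesgueS_sigma_additive : semi_sigma_additive borel_lebesgueS.
Proof.
move=> F mF tF mUF; rewrite /borel_lebesgueS /pushforward preimage_bigcup.
apply: measure_semi_sigma_additive.
- by move=> k; exact: measurable_preimage.
- apply/trivIsetP => /= i j _ _ ij; rewrite -preimage_setI.
  by move/trivIsetP : tF => /(_ _ _ _ _ ij) ->//; rewrite preimage_set0.
- by rewrite -preimage_bigcup; exact: measurable_preimage.
Qed.

HB.instance Definition _ := isMeasure.Build _ _ _ borel_lebesgueS
  borel_lebesgueS0 borel_lebesgueS_ge0 borel_lebesgueS_sigma_additive.

Let borel_lebesgueS_sigma_finite : sigma_finite setT borel_lebesgueS.
Proof.
have /sigma_finiteP[F [FT ndF Foo]] := sigma_finiteT (@lebesgue_measure R).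
have /sigma_finiteP[G [GT ndG Goo]] := sigma_finiteT m.
pose uncons (x : tupleR n.+1) : measurableTypeR R * tupleR n :=
  (tnth x ord0, [tuple of behead x]).
have consK : cancel (@tuple_cons n) uncons.
  by move=> [t x]; rewrite /uncons /tuple_cons/=; congr pair; exact: val_inj.
have muncons : measurable_fun setT uncons.
  apply/measurable_fun_pair; first exact: measurable_tnth.
  exact: measurable_behead.
exists (fun k => uncons @^-1` (F k `*` G k)).
  apply/esym/seteqP; split=> // x _.
  have [i _ Fi] : (\bigcup_i F i) (uncons x).1 by rewrite -FT.
  have [j _ Gj] : (\bigcup_i G i) (uncons x).2 by rewrite -GT.
  exists (maxn i j) => //; split.
  - by move: Fi; exact/subsetPset/ndF/leq_maxl.
  - by move: Gj; exact/subsetPset/ndG/leq_maxr.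
move=> k; have [mF Fkoo] := Foo k; have [mG Gkoo] := Goo k; split.
  by rewrite -[X in measurable X]setTI; apply: muncons => //; exact: measurableX.
rewrite /borel_lebesgueS /pushforward -comp_preimage.
rewrite (_ : uncons \o _ = id) ?preimage_id; last first.
  by apply/funext => z; exact: consK.
by rewrite product_measure1E// lte_mul_pinfty// ge0_fin_numE.
Qed.

HB.instance Definition _ := Measure_isSigmaFinite.Build _ _ _ borel_lebesgueS
  borel_lebesgueS_sigma_finite.

End step.

Fixpoint borel_lebesgue n : {sigma_finite_measure set (tupleR n) -> \bar R} :=
  match n with
  | 0 => \d_[tuple]
  | k.+1 => borel_lebesgueS (borel_lebesgue k)
  end.

End borel_lebesgue.

(* R^n with the sigma-algebra of Lebesgue measurable sets, that is, the
   Caratheodory sigma-algebra of the outer measure extending the Borel-Lebesgue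
   measure; lebesgue is the complete Lebesgue measure on it. *)
Definition Rn (R : realType) n := caratheodory_type ((@borel_lebesgue R n)^*)%mu.

Definition lebesgue {R : realType} {n} : set (Rn R n) -> \bar R :=
  @completed_measure_extension _ _ _ (@borel_lebesgue R n).

HB.instance Definition _ (R : realType) n := Measure.on (@lebesgue R n).

HB.instance Definition _ (R : realType) n :=
  Measure_isSigmaFinite.Build _ _ _ (@lebesgue R n)
    (completed_measure_extension_sigma_finite (sigma_finiteT (borel_lebesgue n))).

Section weights.
Context {R : realType} {n : nat}.
Implicit Types (x : Rn R n) (Q : set (Rn R n)) (f v w : Rn R n -> R).

(* The topology is that of row vectors, tuples having none in the library. *)
Definition row_of x : 'rV[R]_n := \row_i tnth x i.

Definition loc_integrable f := measurable_fun setT f /\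
  forall K : set (Rn R n), compact (row_of @` K) ->
    (\int[lebesgue]_(x in K) `|f x|%:E < +oo)%E.

Definition weight w := (forall x, 0 <= w x) /\ loc_integrable w.

(* Closed nondegenerate cubes with sides parallel to the axes. *)
Definition cubes : set (set (Rn R n)) :=
  [set Q | exists (a : 'I_n -> R) (l : R), 0 < l /\
     Q = [set x | forall i, a i <= tnth x i <= a i + l]].

Definition cubes_at x : set (set (Rn R n)) := [set Q | cubes Q /\ Q x].

Local Open Scope ereal_scope.

Definition average f Q : \bar R :=
  (lebesgue Q)^-1 * \int[lebesgue]_(y in Q) (f y)%:E.

Definition maximal f x : \bar R :=
  ereal_sup [set average (fun y => `|f y|%R) Q | Q in cubes_at x].

(* When the mass w(Q) is 0 the quotient is +oo * 0 = 0 by the conventions of \bar R. *)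
Definition Ainfty_const w : \bar R :=
  ereal_sup [set (\int[lebesgue]_(x in Q) (w x)%:E)^-1 *
                 \int[lebesgue]_(x in Q) maximal (fun y => w y * \1_Q y)%R x
            | Q in cubes].

Definition Ainfty w := weight w /\ Ainfty_const w < +oo.

Definition wnorm (s : R) v (g : Rn R n -> \bar R) : \bar R :=
  (\int[lebesgue]_x (`|g x| `^ s * (v x)%:E)) `^ (s^-1).

Definition wLp (s : R) v f :=
  measurable_fun setT f /\ wnorm s v (EFin \o f) < +oo.

End weights.

Definition conjugate {R : realType} (s : R) : R := (1 - s^-1)^-1.

Section multilinear.
Context {R : realType} {m n : nat}.
Implicit Types (alpha p q s : R) (P : 'I_m -> R).
Implicit Types (u : Rn R n -> R) (w f : 'I_m -> Rn R n -> R).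

(* powR sends 0 to 0, so this is the genuine negative power only where v > 0. *)
Definition dual_weight s (v : Rn R n -> R) : Rn R n -> R :=
  fun x => v x `^ (- conjugate s).

Local Open Scope ereal_scope.

Definition APq_const alpha p q P u w : \bar R :=
  ereal_sup [set lebesgue Q `^ (alpha / n%:R + q^-1 - p^-1)%R *
                 average u Q `^ (q^-1)%R *
                 \prod_(i < m)
                   average (dual_weight (P i) (w i)) Q `^ ((conjugate (P i))^-1)%R
            | Q in cubes].

Definition frac_maximal alpha f (x : Rn R n) : \bar R :=
  ereal_sup [set \prod_(i < m)
                   ((lebesgue Q `^ (1 - alpha / (m * n)%:R)%R)^-1 *
                    \int[lebesgue]_(y in Q) `|f i y|%:E)
            | Q in cubes_at x].

End multilinear.

(* Main.v *)
Require Import Defs.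
From mathcomp Require Import all_boot all_order all_algebra.
From mathcomp Require Import all_classical all_reals all_analysis.
From mathcomp Require Import measurable_realfun ring lra zify.
Import Order.TTheory GRing.Theory Num.Theory.
Import numFieldNormedType.Exports.
Local Open Scope classical_set_scope.
Local Open Scope ring_scope.

(* With sigma_i = w_i^(-p_i') and |f_i| = g_i sigma_i, the weighted norm of f_i is the
   L^(p_i)(sigma_i) norm of g_i, and the A_(P,q) condition bounds
   lam(Q)^q u(Q), where lam(Q) is the quantity in the maximal function, by
   [u,w]^q prod_i ((avg_Q^(sigma_i) g_i)^(p_i) sigma_i(Q))^(q/p_i).
   Every cube lies in a comparable cube of one of 2^n shifted dyadic grids (one-third
   trick), and on a finite part of a grid the maximal function is dominated by a sum over a
   sparse family: cubes Q keeping disjoint (up to multiplicity two) parts of at least half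
   their volume.  Averages of sigma_i bound M(sigma_i 1_R) from below on these parts, so the
   A_infty condition says that the sparse family is Carleson for sigma_i with constant
   4 [sigma_i].  The Carleson embedding theorem and Hoelder's inequality then sum the bound
   over the sparse family, and Fatou's lemma passes to all cubes. *)

(** * Carleson embedding for laminar families *)

(** The constant must not depend on [alpha], and this shapes two choices. In the stopping argument
    the volume enters [avg_prod] with a nonnegative exponent, so passing to a smaller cube cannot
    increase that factor, and the ratio [(2m)^m] serves every [alpha]. In the comparison of a cube
    with a grid cube, the loss [c^(1 - alpha/(mn))] per factor is rounded up to [c = 6^n]. Working
    with a finite part of a grid makes maximal members exist and all sums finite, so nothing about
    the size of the maximal function is assumed beforehand; the bounds are uniform in that finite
    part. Multiplicity two is the price of integer levels: values on consecutive levels can be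
    arbitrarily close, and only a jump of two levels forces a ratio above [(2m)^m]. The constants of
    the weights are suprema over closed cubes, whereas grid cubes are half-open so that any two of
    one grid are nested or disjoint. Integrals do not see the difference, the faces being null
    sets. *)

Section laminar.
Context {T : Type}.
Implicit Types (F : seq (set T)) (A B Q R : set T).

Definition laminar F := forall A B, A \in F -> B \in F ->
  A `<=` B \/ B `<=` A \/ A `&` B = set0.

(** [undup] matters: disjointness only separates distinct members, so a repeated maximal set would
    be counted twice in sums over [maximals F]. *)
Definition maximals F :=
  [seq A <- undup F | `[< forall B, B \in F -> A `<=` B -> B = A >] ].

Lemma maximals_uniq F : uniq (maximals F).
Proof. by rewrite filter_uniq// undup_uniq. Qed.

Lemma mem_maximals F A : A \in maximals F ->
  A \in F /\ forall B, B \in F -> A `<=` B -> B = A.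
Proof. by rewrite mem_filter mem_undup => /andP[/asboolP]. Qed.

Lemma maximals_cover F Q : Q \in F -> exists2 R, R \in maximals F & Q `<=` R.
Proof.
move=> QF; suff [R [RF QR Rm]] : exists R, [/\ R \in F, Q `<=` R &
    forall B, B \in F -> R `<=` B -> B = R].
  by exists R => //; rewrite mem_filter mem_undup RF andbT; apply/asboolP.
elim: F Q QF => // C F IH Q; rewrite inE => /orP[/eqP ->|QF].
- have [[D DF CD]|nD] := pselect (exists2 D, D \in F & C `<=` D).
    have [R [RF DR Rm]] := IH _ DF.
    exists R; split; [by rewrite inE RF orbT|exact: subset_trans DR|].
    move=> B; rewrite inE => /orP[/eqP -> RC|]; last exact: Rm.
    by apply/seteqP; split => //; exact: subset_trans DR.
  exists C; split => //; first by rewrite inE eqxx.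
  move=> B; rewrite inE => /orP[/eqP //|BF CB].
  by exfalso; apply: nD; exists B.
- have [R [RF QR Rm]] := IH _ QF.
  (* If the new head [C] contains the maximal set [R] of the tail, then [C] is maximal: a member of
     the tail containing [C] contains [R], hence equals [R] and lies in [C]. *)
  have [RC|nRC] := pselect (R `<=` C).
    exists C; split => //; [by rewrite inE eqxx|exact: subset_trans RC|].
    move=> B; rewrite inE => /orP[/eqP //|BF CB].
    have E := Rm _ BF (subset_trans RC CB).
    by apply/seteqP; split => //; rewrite E.
  exists R; split => //; first by rewrite inE RF orbT.
  by move=> B; rewrite inE => /orP[/eqP ->//|]; exact: Rm.
Qed.

Lemma maximals_disj F A B : laminar F -> A \in maximals F -> B \in maximals F ->
  A != B -> A `&` B = set0.
Proof.
move=> lF /mem_maximals[AF Am] /mem_maximals[BF Bm] /eqP nAB.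
have [AB|[BA|//]] := lF _ _ AF BF; exfalso; apply: nAB.
- by rewrite (Am _ BF AB).
- by rewrite (Bm _ AF BA).
Qed.

Lemma laminar_filter (a : pred (set T)) F : laminar F -> laminar [seq Q <- F | a Q].
Proof. by move=> lF A B; rewrite !mem_filter => /andP[_ +] /andP[_]; exact: lF. Qed.

(** Every [Q] of [F] occurs on the right under some maximal set containing it; nonnegativity absorbs
    any further occurrence. *)
Lemma sum_maximals {R : realType} F (s : set T -> R) :
  (forall Q, Q \in F -> 0 <= s Q) ->
  \sum_(Q <- F) s Q <=
  \sum_(M <- maximals F) \sum_(Q <- F | `[< Q `<=` M >]) s Q.
Proof.
move=> s0; rewrite (exchange_big_dep xpredT)//= big_seq [leRHS]big_seq.
apply: ler_sum => Q QF.
have [M MF QM] := maximals_cover _ _ QF.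
rewrite big_mkcond (bigD1_seq M) ?maximals_uniq//= asboolT//.
by rewrite lerDl sumr_ge0// => ? _; case: ifP => // _; exact: s0.
Qed.

End laminar.

Lemma ler_sum_subpred {R : numDomainType} {I : Type} (r : seq I) (P Q : pred I)
    (f : I -> R) :
  (forall i, P i -> Q i) -> (forall i, Q i -> 0 <= f i) ->
  \sum_(i <- r | P i) f i <= \sum_(i <- r | Q i) f i.
Proof.
move=> PQ f0; rewrite big_mkcond [leRHS]big_mkcond; apply: ler_sum => i _.
by case: ifPn => [/PQ ->//|_]; case: ifPn => // /f0.
Qed.

(** * Integrals of nonnegative functions and finite sums *)

Section integral_extra.
Local Open Scope ereal_scope.
Context {d} {T : measurableType d} {R : realType}.
Variable mu : {measure set T -> \bar R}.
Import HBNNSimple.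

(* The integral of a nonnegative function is a supremum over the simple functions below
   it, so monotonicity needs no measurability: it is a lower integral.  This is what
   allows the maximal functions, suprema over uncountable families, to stay inside. *)
Lemma ge0_le_lower_integral (D : set T) (f1 f2 : T -> \bar R) :
  (forall x, D x -> 0 <= f1 x) -> (forall x, D x -> f1 x <= f2 x) ->
  \int[mu]_(x in D) f1 x <= \int[mu]_(x in D) f2 x.
Proof.
move=> f10 f12; have f20 x : D x -> 0 <= f2 x.
  by move=> Dx; apply: le_trans (f12 _ Dx); exact: f10.
rewrite !ge0_integralE//; apply: ereal_sup_le => _ [h hf <-].
exists h => // x.
apply: le_trans (hf x) _; rewrite /patch; case: ifPn => // /set_mem; exact: f12.
Qed.

Lemma ge0_integral_sum_seq (I : eqType) (s : seq I) (f : I -> T -> \bar R) :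
  (forall i, i \in s -> measurable_fun setT (f i)) ->
  (forall i x, i \in s -> 0 <= f i x) ->
  \int[mu]_x (\sum_(i <- s) f i x) = \sum_(i <- s) \int[mu]_x f i x.
Proof.
move=> mf f0; pose g i := if i \in s then f i else cst 0.
transitivity (\int[mu]_x (\sum_(i <- s) g i x)).
  by apply: eq_integral => x _; apply: eq_big_seq => i si; rewrite /g si.
rewrite ge0_integral_sum//.
- by apply: eq_big_seq => i si; rewrite /g si.
- by move=> i; rewrite /g; case: ifPn => [/mf//|_]; exact: measurable_cst.
- by move=> i x _; rewrite /g; case: ifPn => // si; exact: f0.
Qed.

Lemma emeasurable_sum_seq (I : eqType) (s : seq I) (f : I -> T -> \bar R) :
  (forall i, i \in s -> measurable_fun setT (f i)) ->
  measurable_fun setT (fun x => \sum_(i <- s) f i x).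
Proof.
elim: s => [|i s IH] mf.
  by apply: (eq_measurable_fun (cst 0)) => [x _|]; rewrite ?big_nil//; exact: measurable_cst.
apply: (eq_measurable_fun (fun x => f i x + \sum_(j <- s) f j x)).
  by move=> x _; rewrite big_cons.
apply: emeasurable_funD; first by apply: mf; rewrite mem_head.
by apply: IH => j js; apply: mf; rewrite in_cons js orbT.
Qed.

Lemma sum_disjoint_integral_le (G : seq (set T)) (h : T -> \bar R) :
  uniq G -> (forall A B, A \in G -> B \in G -> A != B -> A `&` B = set0) ->
  (forall A, A \in G -> measurable A) ->
  measurable_fun setT h -> (forall x, 0 <= h x) ->
  \sum_(A <- G) \int[mu]_(x in A) h x <= \int[mu]_x h x.
Proof.
move=> uG dG mG mh h0.
under eq_bigr do rewrite integral_mkcond.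
rewrite -ge0_integral_sum_seq; last 2 first.
- move=> A AG; apply/(measurable_restrictT h (mG _ AG)).1.
  exact: measurable_funS mh.
- by move=> A x _; apply: erestrict_ge0 => y _.
apply: ge0_le_lower_integral => x _.
  by apply: sume_ge0 => A _; apply: erestrict_ge0 => y _.
have [[A AG Ax]|nA] := pselect (exists2 A, A \in G & A x); last first.
  rewrite big_seq big1 => [|A AG]; first exact: h0.
  by rewrite patchE memNset// => Ax; apply: nA; exists A.
rewrite (bigD1_seq A)//= big_seq_cond big1 ?adde0.
  by rewrite patchE mem_set.
move=> B /andP[BG BA]; rewrite patchE memNset// => Bx.
by have : (B `&` A) x by []; rewrite (dG _ _ BG AG BA).
Qed.

End integral_extra.

(** * Dyadic levels and geometric sums *)

Section dyadic_levels.
Context {R : realType}.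
Implicit Types (a t y p : R) (k K N : nat).

(** The scales 2^(k-N) are indexed by a natural [k < N + N], so that a two-sided range of scales
    becomes an ordinary finite sum. *)
Lemma dyadic_level a N : 2 ^- N <= a < 2 ^+ N ->
  exists2 k, (k < N + N)%N & 2 ^+ k / 2 ^+ N <= a < 2 ^+ k.+1 / 2 ^+ N.
Proof.
move=> /andP[Na aN].
have level_lt : forall K, a < 2 ^+ K / 2 ^+ N -> exists2 k, (k < K)%N &
    2 ^+ k / 2 ^+ N <= a < 2 ^+ k.+1 / 2 ^+ N.
  elim=> [|K IH aK]; first by rewrite expr0 mul1r ltNge Na.
  have [Ka|/IH[k kK ak]] := leP (2 ^+ K / 2 ^+ N) a; first by exists K; rewrite ?Ka.
  by exists k => //; exact: ltnW.
by apply: level_lt; rewrite exprD mulfK// expf_neq0.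
Qed.

(** A discrete layer-cake formula: the single term at the scale of [a] already exceeds [a] after the
    doubling inside the power. *)
Lemma ler_powR_dyadic_sum p a N : 0 < p -> 0 <= a ->
  (0 < a -> 2 ^- N <= a < 2 ^+ N) ->
  a `^ p <= \sum_(k < N + N | 2 ^+ k / 2 ^+ N <= a) (2 * (2 ^+ k / 2 ^+ N)) `^ p.
Proof.
move=> p0 a0; rewrite le_eqVlt in a0; case/orP: a0 => [/eqP <- _|a0 /(_ a0)].
  by rewrite powR0 ?gt_eqF// sumr_ge0// => i _; exact: powR_ge0.
move=> /dyadic_level[k kN /andP[ka ak]].
rewrite (bigD1 (Ordinal kN))//=.
apply: (@le_trans _ _ ((2 * (2 ^+ k / 2 ^+ N)) `^ p)).
  apply: ge0_ler_powR; rewrite ?nnegrE; [exact: ltW|exact: ltW| |].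
    by rewrite mulr_ge0// divr_ge0// exprn_ge0.
  by apply: ltW; rewrite mulrA -exprS.
by rewrite lerDl sumr_ge0// => i _; exact: powR_ge0.
Qed.

Lemma dyadic_levels_exist (l : seq R) :
  exists N, forall a, a \in l -> 0 < a -> 2 ^- N <= a < 2 ^+ N.
Proof.
have mono N M a : (N <= M)%N -> 2 ^- N <= a < 2 ^+ N -> 2 ^- M <= a < 2 ^+ M.
  move=> NM /andP[Na aN]; apply/andP; split.
    apply: le_trans Na; rewrite lef_pV2 ?posrE ?exprn_gt0//.
    by rewrite ler_weXn2l// ler1n.
  by apply: lt_le_trans aN _; rewrite ler_weXn2l// ler1n.
have ge2 (x : R) : exists N, x < 2 ^+ N.
  exists (Num.bound `|x|).
  apply: le_lt_trans (ler_norm x) _; apply: lt_le_trans (archi_boundP _) _ => //.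
  by rewrite -natrX ler_nat ltnW// ltn_expl.
elim: l => [|a l [N HN]]; first by exists 0%N.
have [N1 H1] := ge2 a; have [N2 H2] := ge2 a^-1.
exists (maxn N (maxn N1 N2)) => b; rewrite inE => /orP[/eqP -> a0|bl b0]; last first.
  by apply: mono (HN _ bl b0); rewrite leq_maxl.
apply: (@mono (maxn N1 N2)); first by rewrite leq_maxr.
apply/andP; split.
  rewrite -[leRHS]invrK lef_pV2 ?posrE ?exprn_gt0 ?invr_gt0//.
  by apply: le_trans (ltW H2) _; rewrite ler_weXn2l ?ler1n// leq_maxr.
by apply: lt_le_trans H1 _; rewrite ler_weXn2l ?ler1n// leq_maxl.
Qed.

Definition geom_const p := (1 - 2 `^ (- p))^-1 : R.

Lemma geom_const_gt0 p : 0 < p -> 0 < geom_const p.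
Proof.
move=> p0; rewrite invr_gt0 subr_gt0 -{2}(powRr0 2) /powR.
by rewrite pnatr_eq0/= ltr_expR ltr_pM2r ?oppr_lt0// ln_gt0// ltr1n.
Qed.

Lemma geometric_sum_le p t K : 0 < p -> 0 <= t ->
  \sum_(k < K.+1) (2 ^+ k * t) `^ p <= geom_const p * (2 ^+ K * t) `^ p.
Proof.
move=> p0 t0; have c0 := geom_const_gt0 _ p0.
(* The geometric constant is the fixed point of c = c 2^(-p) + 1, which is exactly what the
   induction step needs: the sum is read from its top term downwards. *)
have cE : geom_const p = geom_const p * 2 `^ (- p) + 1.
  have : geom_const p * (1 - 2 `^ (- p)) = 1.
    by rewrite mulVf// gt_eqF// -invr_gt0.
  by rewrite mulrBr mulr1 => H; rewrite -{2}H addrC subrK.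
elim: K => [|K IH].
  rewrite big_ord1 cE mulrDl mul1r lerDr.
  by rewrite !mulr_ge0// ?powR_ge0// ltW.
rewrite big_ord_recr/=; apply: le_trans (lerD IH (lexx _)) _.
rewrite [in leRHS]cE mulrDl mul1r lerD2r -mulrA ler_pM2l// exprS -mulrA.
rewrite [in leRHS]powRM ?mulr_ge0 ?exprn_ge0// mulrA -powRD ?subrr ?addNr ?powRr0 ?mul1r//.
by rewrite pnatr_eq0 implybT.
Qed.

Lemma dyadic_geometric_sum_le p t y K : 0 < p -> 0 <= t -> 0 <= y ->
  \sum_(k < K | 2 ^+ k * t <= y) (2 ^+ k * t) `^ p <= geom_const p * y `^ p.
Proof.
move=> p0 t0 y0; have c0 := geom_const_gt0 _ p0.
elim: K => [|K IH]; first by rewrite big_ord0 mulr_ge0 ?powR_ge0// ltW.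
have [Ky|yK] := leP (2 ^+ K * t) y; last first.
  rewrite big_mkcond big_ord_recr/= [in X in _ + X]leNgt [in X in _ + X]yK/= addr0.
  by rewrite -big_mkcond/=; exact: IH.
apply: (@le_trans _ _ (\sum_(k < K.+1) (2 ^+ k * t) `^ p)).
  by apply: ler_sum_subpred => // i _; exact: powR_ge0.
apply: le_trans (geometric_sum_le _ _ _ p0 t0) _.
rewrite ler_pM2l// ge0_ler_powR ?nnegrE// ?mulr_ge0 ?exprn_ge0//; exact: ltW.
Qed.

End dyadic_levels.

(** The factor 2^(p+1) comes from (2t)^p * (2/t) = 2^(p+1) t^(p-1), that is, the layer-cake term
    times the bound of a level set. The rest bounds the sum of t^(p-1) over the dyadic t <= 2g by
    [geom_const (p - 1)] times (2g)^(p-1). *)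
Definition carleson_const {R : realType} (p : R) : R :=
  2 `^ (p + 1) * 2 `^ (p - 1) * geom_const (p - 1).

Section carleson.
Context {d} {T : measurableType d} {R : realType}.
Variable mu : {measure set T -> \bar R}.
Variables (g sigma : T -> R) (F : seq (set T)) (s phi : set T -> R) (b : R).
Hypotheses (mg : measurable_fun setT g) (ms : measurable_fun setT sigma).
Hypotheses (g0 : forall x, 0 <= g x) (sigma0 : forall x, 0 <= sigma x).
Hypotheses (lF : laminar F) (mF : forall Q, Q \in F -> measurable Q).
Hypothesis s0 : forall Q, Q \in F -> 0 < s Q.
Hypothesis sE : forall Q, Q \in F -> (\int[mu]_(x in Q) (sigma x)%:E = (s Q)%:E)%E.
Hypothesis phiE : forall Q, Q \in F ->
  (\int[mu]_(x in Q) (g x * sigma x)%:E = (phi Q)%:E)%E.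
Hypothesis b0 : 0 <= b.
Hypothesis packing : forall M, M \in F ->
  \sum_(Q <- F | `[< Q `<=` M >]) s Q <= b * s M.

Let mgs : measurable_fun setT (fun x => g x * sigma x).
Proof. exact: measurable_funM. Qed.

Let msup t : measurable [set x | t <= g x].
Proof.
have := mg measurableT `[t, +oo[%classic (measurable_itv _).
by rewrite setTI preimage_itvcy.
Qed.

Let trunc (t : R) x := (g x * sigma x) * \1_[set y | t <= g y] x.

Let mtrunc t : measurable_fun setT (trunc t).
Proof. by apply: measurable_funM => //; exact: measurable_indic. Qed.

Let trunc0 t x : 0 <= trunc t x.
Proof. by rewrite /trunc !mulr_ge0. Qed.

(* On a maximal M with average at least t, the part of the mass where g < t / 2 is at most
   half of t s(M), so s(M) is controlled by the mass where g >= t / 2. *)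
Lemma carleson_level (t : R) : 0 < t ->
  ((\sum_(Q <- F | t <= phi Q / s Q) s Q)%:E <=
   (b * (2 / t))%:E * \int[mu]_x (trunc (t / 2) x)%:E)%E.
Proof.
move=> t0; set H := [seq Q <- F | t <= phi Q / s Q].
have HF Q : Q \in H -> Q \in F by rewrite mem_filter => /andP[].
have lH : laminar H by exact: laminar_filter.
have mlF Q : Q \in maximals H -> Q \in F by move=> /mem_maximals[/HF].
rewrite -big_filter -/H.
have -> : (b * (2 / t))%:E = (b%:E * (2 / t)%:E)%E :> \bar R by rewrite EFinM.
rewrite -muleA.
apply: (@le_trans _ _ (b%:E * \sum_(M <- maximals H) (s M)%:E)%E).
  rewrite sumEFin -EFinM lee_fin.
  apply: le_trans (sum_maximals _ s _) _ => [Q /HF /s0 /ltW//|].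
  rewrite mulr_sumr big_seq [leRHS]big_seq; apply: ler_sum => M /mlF MF.
  apply: le_trans (packing _ MF); rewrite big_filter_cond/=.
  rewrite big_seq_cond [leRHS]big_seq_cond.
  apply: ler_sum_subpred => Q; first by move=> /and3P[-> _ ->].
  by move=> /andP[QF _]; exact/ltW/s0.
apply: lee_wpmul2l; first by rewrite lee_fin.
apply: (@le_trans _ _ ((2 / t)%:E *
   \sum_(M <- maximals H) \int[mu]_(x in M) (trunc (t / 2) x)%:E)%E).
  rewrite ge0_sume_distrr; last first.
    by move=> M _; apply: integral_ge0 => x _; rewrite lee_fin.
  rewrite big_seq [leRHS]big_seq; apply: lee_sum => M MH.
  have MF := mlF _ MH; have mM := mF _ MF.
  have sM := s0 _ MF.
  have tM : t * s M <= phi M.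
    by move: MH => /mem_maximals[]; rewrite mem_filter ler_pdivlMr// => /andP[].
  have le1 : ((phi M)%:E <= \int[mu]_(x in M) (trunc (t / 2) x)%:E
                            + (t / 2 * s M)%:E)%E.
    rewrite -phiE// EFinM -sE// -ge0_integralZl_EFin//; last 3 first.
    - by move=> x _; rewrite lee_fin.
    - by apply/measurable_EFinP; exact: measurable_funS ms.
    - by rewrite divr_ge0// ltW.
    rewrite -ge0_integralD//; last 4 first.
    - by move=> x _; rewrite lee_fin.
    - by apply/measurable_EFinP; exact: measurable_funS (mtrunc _).
    - by move=> x _; rewrite -EFinM lee_fin mulr_ge0// divr_ge0// ltW.
    - apply/measurable_EFinP; apply: measurable_funM => //.
      exact: measurable_funS ms.
    apply: ge0_le_lower_integral => x _; first by rewrite lee_fin mulr_ge0.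
    rewrite -EFinM -EFinD lee_fin /trunc indicE.
    case: (boolP (x \in _)) => [_|/negP xn].
      by rewrite mulr1 lerDl mulr_ge0// divr_ge0// ltW.
    rewrite mulr0 add0r ler_wpM2r//.
    by rewrite leNgt; apply/negP => /ltW gx; apply: xn; rewrite inE.
  have I0 : (0 <= \int[mu]_(x in M) (trunc (t / 2) x)%:E)%E.
    by apply: integral_ge0 => x _; rewrite lee_fin.
  case: (\int[mu]_(x in M) (trunc (t / 2) x)%:E)%E I0 le1 => [r||]//=; last first.
    by move=> _ _; rewrite gt0_muley ?leey// lte_fin divr_gt0.
  rewrite lee_fin => r0; rewrite -EFinD lee_fin => le1.
  rewrite -EFinM lee_fin mulrAC ler_pdivlMr//.
  by rewrite -ler_pdivrMl// ; lra.
apply: lee_wpmul2l; first by rewrite lee_fin divr_ge0// ltW.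
apply: sum_disjoint_integral_le.
- exact: maximals_uniq.
- by move=> A B AH BH; exact: (@maximals_disj _ H).
- by move=> A /mlF /mF.
- exact/measurable_EFinP.
- by move=> x; rewrite lee_fin.
Qed.
(** The averages are split into dyadic levels and [carleson_level] is applied at each one. After
    exchanging sum and integral, the levels active at a point x are those with t <= 2 g(x), and
    since p - 1 > 0 the powers t^(p-1) form a geometric sum governed by its largest term. *)
Theorem carleson_embedding (p : R) : 1 < p ->
  ((\sum_(Q <- F) (phi Q / s Q) `^ p * s Q)%:E <=
   (carleson_const p * b)%:E * \int[mu]_x (g x `^ p * sigma x)%:E)%E.
Proof.
move=> p1; have p0 : 0 < p by exact: lt_trans p1.
have p10 : 0 < p - 1 by rewrite subr_gt0.
have phi0 Q : Q \in F -> 0 <= phi Q.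
  move=> QF; rewrite -lee_fin -phiE//; apply: integral_ge0 => x _.
  by rewrite lee_fin mulr_ge0.
have [N HN] := dyadic_levels_exist [seq phi Q / s Q | Q <- F].
pose t k : R := 2 ^+ k / 2 ^+ N.
have t0 k : 0 < t k by rewrite divr_gt0// exprn_gt0.
pose w k := (2 * t k) `^ p * (b * (2 / t k)).
have w0 k : 0 <= w k.
  by rewrite mulr_ge0 ?powR_ge0// mulr_ge0// divr_ge0// ltW.
apply: (@le_trans _ _ (\sum_(k < N + N)
    (w k)%:E * \int[mu]_x (trunc (t k / 2) x)%:E)%E).
  apply: (@le_trans _ _ (\sum_(k < N + N) (2 * t k) `^ p *
      \sum_(Q <- F | t k <= phi Q / s Q) s Q)%:E).
    rewrite lee_fin (@le_trans _ _ (\sum_(Q <- F)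
      (\sum_(k < N + N | t k <= phi Q / s Q) (2 * t k) `^ p) * s Q))//.
      rewrite big_seq [leRHS]big_seq; apply: ler_sum => Q QF.
      rewrite ler_pM2r ?s0//; apply: ler_powR_dyadic_sum => //.
        by rewrite divr_ge0 ?phi0// ltW// s0.
      by apply: HN; exact: map_f.
    under eq_bigr do rewrite big_mkcond mulr_suml.
    rewrite exchange_big/=; apply: ler_sum => k _.
    rewrite mulr_sumr [leRHS]big_mkcond/=; apply: ler_sum => Q _.
    by case: ifP => //; rewrite mul0r.
  rewrite -sumEFin; apply: lee_sum => k _; rewrite EFinM.
  apply: le_trans (lee_wpmul2l _ (carleson_level _ (t0 k))) _.
    by rewrite lee_fin powR_ge0.
  by rewrite muleA -EFinM.
under eq_bigr => k _.
  rewrite -ge0_integralZl_EFin//; last 2 first.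
  - by move=> x _; rewrite lee_fin.
  - exact/measurable_EFinP.
  over.
rewrite -ge0_integral_sum//; last 2 first.
- move=> k; apply: measurable_funeM; exact/measurable_EFinP.
- by move=> k x _; rewrite -EFinM lee_fin mulr_ge0.
have c0 : 0 <= carleson_const p.
  by rewrite !mulr_ge0 ?powR_ge0// ltW// geom_const_gt0.
rewrite -ge0_integralZl_EFin//; last 3 first.
- by move=> x _; rewrite lee_fin mulr_ge0// powR_ge0.
- apply/measurable_EFinP/measurable_funM => //.
  exact: measurableT_comp (measurable_powR _) mg.
- by rewrite mulr_ge0.
apply: ge0_le_lower_integral => x _.
  by apply: sume_ge0 => k _; rewrite -EFinM lee_fin mulr_ge0.
rewrite -EFinM sumEFin lee_fin.
have -> : \sum_(k < N + N) w k * trunc (t k / 2) x =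
    b * 2 `^ (p + 1) * (g x * sigma x) *
    \sum_(k < N + N | 2 ^+ k * (2 ^+ N)^-1 <= 2 * g x) (2 ^+ k * (2 ^+ N)^-1) `^ (p - 1).
  rewrite big_distrr [RHS]big_mkcond/=; apply: eq_bigr => k _.
  have -> : (2 ^+ k / 2 ^+ N <= 2 * g x) = (x \in [set y | t k / 2 <= g y]).
    have E : (t k / 2 <= g x) = (t k <= 2 * g x).
      by rewrite ler_pdivrMr// [g x * 2]mulrC.
    by apply/idP/idP => [H|]; rewrite inE/= E.
  rewrite /trunc indicE -/(t k).
  case: ifP => _; last by rewrite !mulr0.
  rewrite mulr1 /w powRM ?ltW// powRD ?powRr1 ?pnatr_eq0 ?implybT//.
  rewrite -(mulr_powRB1 (ltW (t0 k)) p0).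
  by field; rewrite gt_eqF.
have -> : carleson_const p * b * (g x `^ p * sigma x) =
   b * 2 `^ (p + 1) * (g x * sigma x) * (geom_const (p - 1) * (2 * g x) `^ (p - 1)).
  by rewrite powRM// -(mulr_powRB1 (g0 x) p0) /carleson_const; ring.
apply: ler_wpM2l; first by rewrite !mulr_ge0 ?powR_ge0.
by apply: dyadic_geometric_sum_le => //; rewrite ?invr_ge0 ?exprn_ge0 ?mulr_ge0.
Qed.
End carleson.

(** * Hoelder's inequality for finite sums *)

Section hoelder_finite.
Context {R : realType} {I : finType}.
Implicit Types (theta x T : I -> R).

(** After division by the mean [s], each factor satisfies y^theta <= exp(theta (y - 1)), and these
    exponents add up to zero. When [s] vanishes, some [x i] with nonzero exponent vanishes too. *)
Lemma weighted_amgm theta x : (forall i, 0 <= theta i) -> \sum_i theta i = 1 ->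
  (forall i, 0 <= x i) -> \prod_i x i `^ theta i <= \sum_i theta i * x i.
Proof.
move=> th0 th1 x0; set s := \sum_i _.
have s_ge0 : 0 <= s by apply: sumr_ge0 => i _; rewrite mulr_ge0.
have [s0|s0] := eqVneq s 0.
  have [i thi] : exists i, theta i != 0.
    apply/existsP; apply: contraT; rewrite negb_exists => /forallP H.
    move: th1; rewrite big1 => [/eqP|i _]; first by rewrite eq_sym oner_eq0.
    by apply/eqP; have := H i; rewrite negbK.
  have xi0 : x i = 0.
    have /eqP : s = 0 by [].
    rewrite psumr_eq0 => [/allP/(_ i)|j _]; last by rewrite mulr_ge0.
    by rewrite mem_index_enum => /(_ isT)/=; rewrite mulf_eq0 (negPf thi) => /eqP.
  by rewrite (bigD1 i)//= xi0 powR0// mul0r s0.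
have sp : 0 < s by rewrite lt_neqAle eq_sym s0.
have -> : \prod_i x i `^ theta i = s * \prod_i (x i / s) `^ theta i.
  rewrite [X in X * _](_ : _ = \prod_i s `^ theta i).
    rewrite -big_split/=; apply: eq_bigr => i _.
    by rewrite -powRM ?divr_ge0// mulrCA divff// mulr1.
  suff sE (y : I -> R) : \prod_i s `^ y i = s `^ (\sum_i y i).
    by rewrite sE th1 powRr1.
  elim/big_ind2 : _ => [|a b c d -> ->|//]; first by rewrite powRr0.
  by rewrite powRD// s0 implybT.
rewrite ler_piMr//.
have yexp i : (x i / s) `^ theta i <= expR (theta i * (x i / s - 1)).
  have -> : expR (theta i * (x i / s - 1)) = expR (x i / s - 1) `^ theta i.
    by rewrite /powR gt_eqF ?expR_gt0// expRK.
  apply: ge0_ler_powR; rewrite ?nnegrE ?expR_ge0 ?divr_ge0//.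
  by apply: le_trans (expR_ge1Dx _); rewrite addrC subrK.
apply: (@le_trans _ _ (\prod_i expR (theta i * (x i / s - 1)))).
  by apply: ler_prod => i _; rewrite powR_ge0 yexp.
rewrite -expR_sum -[leRHS]expR0 ler_expR.
have -> : \sum_i theta i * (x i / s - 1) = s / s - 1.
  under eq_bigr do rewrite mulrBr mulr1 mulrA.
  by rewrite big_split/= sumrN th1 -mulr_suml.
by rewrite divff// subrr.
Qed.

(** If some [T i] is zero, every product vanishes; otherwise the terms are normalized by [T i], and
    the weighted arithmetic-geometric inequality is summed over [r]. *)
Lemma hoelder_sum (J : eqType) (r : seq J) theta (a : I -> J -> R) T :
  (forall i, 0 < theta i) -> \sum_i theta i = 1 ->
  (forall i j, j \in r -> 0 <= a i j) ->
  (forall i, \sum_(j <- r) a i j <= T i) ->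
  \sum_(j <- r) \prod_i a i j `^ theta i <= \prod_i T i `^ theta i.
Proof.
move=> th0 th1 a0 aT.
have T0 i : 0 <= T i.
  by apply: le_trans (aT i); rewrite big_seq sumr_ge0// => j; exact: a0.
have [/existsP[i /eqP Ti0]|] := boolP [exists i, T i == 0].
  rewrite (bigD1 i)//= Ti0 powR0 ?gt_eqF// mul0r big_seq big1// => j jr.
  have aij0 : a i j = 0.
    apply/eqP; rewrite eq_le a0// andbT -Ti0; apply: le_trans (aT i).
    rewrite big_seq; rewrite (big_rem j)//= jr lerDl big_seq_cond sumr_ge0// => k.
    by move=> /andP[_]; exact: a0.
  by rewrite (bigD1 i)//= aij0 powR0 ?gt_eqF// mul0r.
rewrite negb_exists => /forallP Tn0.
have Tp i : 0 < T i by rewrite lt_neqAle eq_sym Tn0 T0.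
have PT0 : 0 < \prod_i T i `^ theta i by apply: prodr_gt0 => i _; exact: powR_gt0.
rewrite -[leRHS]mul1r -ler_pdivrMr// mulr_suml.
apply: (@le_trans _ _ (\sum_(j <- r) \sum_i theta i * (a i j / T i))).
  rewrite big_seq [leRHS]big_seq; apply: ler_sum => j jr.
  apply: le_trans (weighted_amgm theta (fun i => a i j / T i) _ th1 _) => [|i|i].
  - rewrite -prodf_div le_eqVlt; apply/orP; left; apply/eqP.
    apply: eq_bigr => i _; rewrite powRM ?invr_ge0 ?a0//; congr (_ * _).
    by rewrite -powR_inv1// -powRrM mulN1r powRN.
  - exact: ltW.
  - by rewrite divr_ge0// a0.
rewrite exchange_big/= -th1; apply: ler_sum => i _.
rewrite -mulr_sumr -mulr_suml -[leRHS]mulr1 ler_pM2l// ler_pdivrMr// mul1r.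
exact: aT.
Qed.

End hoelder_finite.

(** * Sparse families *)

Section level.
Context {R : realType}.
Implicit Types a x y : R.

(** For a > 1 and x > 0 this is the integer k with a^k <= x < a^(k+1). *)
Definition level a x : int := Num.floor (ln x / ln a).

Lemma level_leD1 a x y : 1 < a -> 0 < x -> 0 < y -> x <= a * y ->
  level a x <= level a y + 1.
Proof.
move=> a1 x0 y0 xy; have la : 0 < ln a by exact: ln_gt0.
have a0 : 0 < a by exact: lt_trans a1.
have H : ln x / ln a <= ln y / ln a + 1.
  rewrite ler_pdivrMr// mulrDl mul1r divfK ?gt_eqF// addrC -lnM//.
  by rewrite ler_ln ?posrE// mulr_gt0.
rewrite -ltzD1 -(ltr_int R) /level.
apply: le_lt_trans (floor_le _) _; apply: le_lt_trans H _.
by rewrite [ltRHS]intrD ltrD2r floorD1_gt.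
Qed.

Lemma level_le a x y : 1 < a -> 0 < x -> 0 < y -> level a x <= level a y ->
  x <= a * y.
Proof.
move=> a1 x0 y0 xy; have la : 0 < ln a by exact: ln_gt0.
have a0 : 0 < a by exact: lt_trans a1.
rewrite -ler_ln ?posrE// ?mulr_gt0// lnM//.
suff : ln x / ln a <= 1 + ln y / ln a.
  by rewrite ler_pdivrMr// mulrDl mul1r divfK ?gt_eqF.
apply: (le_trans (ltW (floorD1_gt _))).
rewrite intrD addrC lerD2l; apply: le_trans (floor_le _).
by rewrite ler_int.
Qed.

End level.

Section sparse.
Context {d} {T : measurableType d} {R : realType} {m : nat}.
Variable mu : {measure set T -> \bar R}.
Variables (F : seq (set T)) (f : 'I_m -> T -> R) (v : set T -> R)
  (phi : 'I_m -> set T -> R) (beta : R).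
Hypothesis m0 : (0 < m)%N.
Hypotheses (lF : laminar F) (mF : forall Q, Q \in F -> measurable Q).
Hypothesis v0 : forall Q, Q \in F -> 0 < v Q.
Hypothesis vE : forall Q, Q \in F -> mu Q = (v Q)%:E.
Hypotheses (mf : forall i, measurable_fun setT (f i)) (f0 : forall i x, 0 <= f i x).
Hypothesis phiE : forall i Q, Q \in F ->
  (\int[mu]_(x in Q) (f i x)%:E = (phi i Q)%:E)%E.
Hypothesis beta0 : 0 <= beta.

(** With [beta] = alpha/n and [v] the volume, this is the quantity whose supremum is the fractional
    maximal function, the m powers |Q|^(alpha/(mn)) being gathered in one factor. *)
Definition avg_prod Q := v Q `^ beta * \prod_(i < m) (phi i Q / v Q).

Definition sparse_ratio : R := (2 * m)%:R ^+ m.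

Local Notation lam := avg_prod.
Local Notation a := sparse_ratio.
Local Notation lev Q := (level a (lam Q)).

(* For each k, the cubes of F that are maximal among those of level at least k and whose
   level is exactly k. *)
Definition sparse_family := [seq Q <- undup F | (0 < lam Q) &&
  `[< forall M, M \in F -> Q `<=` M -> M <> Q -> 0 < lam M -> lev M < lev Q >] ].

Local Notation S := sparse_family.

Lemma sparse_ratio_gt1 : 1 < a.
Proof.
rewrite /a -natrX ltr1n; apply: (@leq_trans (2 * m)); first by rewrite leq_pmulr.
by rewrite -{1}(expn1 (2 * m)) leq_pexp2l// muln_gt0.
Qed.

Let a1 := sparse_ratio_gt1.

Let a0 : 0 < a. Proof. exact: lt_trans a1. Qed.

Let phi0 i Q : Q \in F -> 0 <= phi i Q.
Proof.
move=> QF; rewrite -lee_fin -phiE//; apply: integral_ge0 => x _.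
by rewrite lee_fin.
Qed.

Lemma mem_sparse Q : Q \in S -> [/\ Q \in F, 0 < lam Q &
  forall M, M \in F -> Q `<=` M -> M <> Q -> 0 < lam M -> lev M < lev Q].
Proof. by rewrite mem_filter mem_undup => /andP[/andP[l /asboolP H] QF]. Qed.

(** [M] is maximal above [Q] among the sets of level at least that of [Q]. All larger sets with
    [lam] positive then have lower level than [Q], hence than [M], which puts [M] in the sparse
    family. Comparing through levels costs the factor [a]. *)
Lemma sparse_dominates Q : Q \in F -> 0 < lam Q ->
  exists2 M, M \in S & Q `<=` M /\ lam Q <= a * lam M.
Proof.
move=> QF l0; pose G := [seq M <- F | (0 < lam M) && (lev Q <= lev M)].
have QG : Q \in G by rewrite mem_filter l0 lexx QF.
have [M /mem_maximals[]] := maximals_cover _ _ QG.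
rewrite mem_filter => /andP[/andP[lM QM] MF] Mmax sQM.
exists M; last by split => //; exact: level_le.
rewrite mem_filter mem_undup MF lM andbT/=; apply/asboolP => M' M'F MM' nM lM'.
rewrite ltNge; apply/negP => le; apply: nM; apply: Mmax => //.
by rewrite mem_filter M'F lM' (le_trans QM).
Qed.

Definition big_subsets Q := [seq M <- F | `[< M `<=` Q >] && (a * lam Q < lam M)].

Definition sparse_part Q := Q `\` \big[setU/set0]_(M <- big_subsets Q) M.

Let E := sparse_part.

Let bigU_measurable (s : seq (set T)) : (forall A, A \in s -> measurable A) ->
  measurable (\big[setU/set0]_(A <- s) A).
Proof. by move=> H; rewrite big_seq; apply: bigsetU_measurable. Qed.

Let big_sub Q M : M \in big_subsets Q -> M \in F.
Proof. by rewrite mem_filter => /andP[]. Qed.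

Lemma measurable_sparse_part Q : Q \in F -> measurable (E Q).
Proof.
move=> QF; apply: measurableD; first exact: mF.
by apply: bigU_measurable => A /big_sub/mF.
Qed.

Let bigU_le (s : seq (set T)) : (forall A, A \in s -> measurable A) ->
  (mu (\big[setU/set0]_(A <- s) A) <= \sum_(A <- s) mu A)%E.
Proof.
elim: s => [|A s IH] H; first by rewrite !big_nil measure0.
have mA : measurable A by apply: H; rewrite inE eqxx.
have mB : measurable (\big[setU/set0]_(A <- s) A).
  by apply: bigU_measurable => B Bs; apply: H; rewrite inE Bs orbT.
rewrite !big_cons; apply: (le_trans (measureU2 mu mA mB)).
by apply: leeD => //; apply: IH => B Bs; apply: H; rewrite inE Bs orbT.
Qed.

Let bigUP (s : seq (set T)) x : (\big[setU/set0]_(A <- s) A) x <->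
  exists2 A, A \in s & A x.
Proof. by rewrite -bigcup_seq; split => [[A As Ax]|[A As Ax]]; exists A. Qed.

Let phi_sum i Q : Q \in F ->
  \sum_(M <- maximals (big_subsets Q)) phi i M <= phi i Q.
Proof.
move=> QF; rewrite -lee_fin -sumEFin.
have sub M : M \in maximals (big_subsets Q) -> M \in F /\ M `<=` Q.
  by move=> /mem_maximals[]; rewrite mem_filter => /andP[/andP[/asboolP]].
apply: (@le_trans _ _ (\sum_(M <- maximals (big_subsets Q))
    \int[mu]_(x in M) ((EFin \o f i) \_ Q) x)%E).
  rewrite big_seq [leRHS]big_seq; apply: lee_sum => M /sub[MF MQ].
  rewrite -phiE//; apply: ge0_le_lower_integral => x Mx; rewrite ?lee_fin//.
  by rewrite patchE mem_set//; exact: MQ.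
rewrite -phiE// [leRHS]integral_mkcond; apply: sum_disjoint_integral_le.
- exact: maximals_uniq.
- by move=> A B; apply: maximals_disj; exact: laminar_filter.
- by move=> A /sub[/mF].
- apply/(measurable_restrictT _ (mF _ QF)).1/measurable_EFinP.
  exact: measurable_funS (mf i).
- by move=> x; apply: erestrict_ge0 => y _; rewrite lee_fin.
Qed.

Let lam_gt0 Q i : Q \in F -> 0 < lam Q -> 0 < phi i Q.
Proof.
move=> QF l0; rewrite lt_neqAle phi0// andbT eq_sym; apply/eqP => p0.
by move: l0; rewrite /lam (bigD1 i)//= p0 mul0r mul0r mulr0 ltxx.
Qed.

(* If lam M > (2m)^m lam Q with M inside Q, then some factor satisfies
   phi i M / v M > 2m phi i Q / v Q since v M <= v Q and beta >= 0; so disjoint such M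
   with a given i have total volume at most v Q / (2m). *)
Lemma sparse_part_half Q : Q \in F -> 0 < lam Q -> ((v Q / 2)%:E <= mu (E Q))%E.
Proof.
move=> QF l0; have mQ := mF _ QF; pose B := \big[setU/set0]_(M <- big_subsets Q) M.
have mB : measurable B by apply: bigU_measurable => A /big_sub/mF.
pose G := maximals (big_subsets Q).
have GF M : M \in G -> M \in F by move=> /mem_maximals[/big_sub].
have BG : B `<=` \big[setU/set0]_(M <- G) M.
  move=> x /bigUP[M /maximals_cover[M' M'G MM'] Mx]; apply/bigUP.
  by exists M' => //; exact: MM'.
have muB : (mu B <= (v Q / 2)%:E)%E.
  apply: (@le_trans _ _ (mu (\big[setU/set0]_(M <- G) M))).
    by apply: le_measure; rewrite ?inE//; apply: bigU_measurable => A /GF/mF.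
  apply: le_trans (bigU_le _ _) _; first by move=> A /GF/mF.
  rewrite big_seq; under eq_bigr => M MG do rewrite vE ?GF//.
  rewrite -big_seq sumEFin lee_fin.
  apply: (@le_trans _ _ (\sum_(M <- G) \sum_(i < m)
      phi i M * (v Q / ((2 * m)%:R * phi i Q)))).
    rewrite big_seq [leRHS]big_seq; apply: ler_sum => M MG.
    have MF := GF _ MG; have pM i := phi0 i _ MF; have pQ i := lam_gt0 _ i QF l0.
    have t0 i : 0 < v Q / ((2 * m)%:R * phi i Q).
      by rewrite divr_gt0 ?v0// mulr_gt0// ltr0n muln_gt0.
    have [i Hi] : exists i, (2 * m)%:R * (phi i Q / v Q) < phi i M / v M.
      apply/existsP; apply: contraT; rewrite negb_exists => /forallP H.
      move: MG => /mem_maximals[]; rewrite mem_filter => /andP[/andP[/asboolP MQ lt]].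
      move=> _ _; move: lt; rewrite ltNge => /negP[].
      rewrite /lam mulrCA; apply: ler_pM; rewrite ?powR_ge0//.
      - by apply: prodr_ge0 => i _; rewrite divr_ge0// ltW// v0.
      - apply: ge0_ler_powR; rewrite ?nnegrE//; try by apply/ltW/v0.
        by rewrite -lee_fin -!vE//; apply: le_measure; rewrite ?inE//; exact: mF.
      - rewrite /a -[X in _ ^+ X]card_ord -prodr_const -big_split/=.
        apply: ler_prod => i _; rewrite divr_ge0//=; last by rewrite ltW// v0.
        by rewrite leNgt H.
    rewrite (bigD1 i)//=; apply: (@le_trans _ _ (phi i M * (v Q / ((2 * m)%:R * phi i Q)))).
      move: Hi; rewrite ltr_pdivlMr ?v0// => /ltW.
      rewrite mulrA mulrAC ler_pdivrMr ?v0// => Hi.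
      rewrite mulrA ler_pdivlMr; last by rewrite mulr_gt0// ltr0n muln_gt0.
      by rewrite mulrC.
    by rewrite lerDl sumr_ge0// => j _; rewrite mulr_ge0// ltW.
  rewrite exchange_big/=; apply: (@le_trans _ _ (\sum_(i < m) v Q / (2 * m)%:R)).
    apply: ler_sum => i _; rewrite -mulr_suml.
    have pQ := lam_gt0 _ i QF l0.
    have t0 : 0 < v Q / ((2 * m)%:R * phi i Q).
      by rewrite divr_gt0 ?v0// mulr_gt0// ltr0n muln_gt0.
    apply: (le_trans (ler_wpM2r (ltW t0) (phi_sum i _ QF))).
    rewrite le_eqVlt; apply/orP; left; apply/eqP.
    have mN : m%:R != 0 :> R by rewrite pnatr_eq0 -lt0n.
    by rewrite natrM; field; rewrite mN gt_eqF.
  rewrite sumr_const card_ord -mulr_natl natrM le_eqVlt; apply/orP; left; apply/eqP.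
  by field; rewrite pnatr_eq0 -lt0n.
have finB : mu (Q `&` B) \is a fin_num.
  rewrite ge0_fin_numE//; apply: (@le_lt_trans _ _ (mu B)).
    by apply: le_measure; rewrite ?inE//; exact: measurableI.
  by apply: le_lt_trans muB _; rewrite ltry.
have muQB : (mu (Q `&` B) <= (v Q / 2)%:E)%E.
  by apply: le_trans muB; apply: le_measure; rewrite ?inE//; exact: measurableI.
have : (mu Q = mu (sparse_part Q) + mu (Q `&` B))%E by exact: measureDI.
rewrite (vE _ QF) -/(sparse_part Q).
case: (mu (sparse_part Q)) => [r||]; last 2 first.
- by move=> _; rewrite leey.
- by move: finB; case: (mu (Q `&` B)).
move: muQB finB; case: (mu (Q `&` B)) => [t||]//.
by rewrite !lee_fin -EFinD => ht _ [] vQ; lra.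
Qed.

(* The members containing x form a chain with increasing levels, and a jump of two levels
   from Q means that x lies in big_subsets Q. *)
Lemma sparse_overlap x : (size [seq Q <- S | `[< E Q x >] ] <= 2)%N.
Proof.
set L := [seq _ <- _ | _].
have uL : uniq L by rewrite filter_uniq// filter_uniq// undup_uniq.
have LS Q : Q \in L -> E Q x /\ Q \in S.
  by rewrite mem_filter => /andP[/asboolP].
have H Q1 Q2 : Q1 \in L -> Q2 \in L -> Q1 != Q2 ->
    (lev Q1 = lev Q2 + 1) \/ (lev Q2 = lev Q1 + 1).
  wlog : Q1 Q2 / Q1 `<=` Q2.
    move=> W Q1L Q2L nQ.
    have [[Q1x _] /mem_sparse[Q1F _ _]] := LS _ Q1L.
    have [[Q2x _] /mem_sparse[Q2F _ _]] := LS _ Q2L.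
    have [Q12|[Q21|Q120]] := lF _ _ Q1F Q2F; first exact: W.
      by have [] := W _ _ Q21 Q2L Q1L; rewrite 1?eq_sym//; [right|left].
    by have : (Q1 `&` Q2) x by []; rewrite Q120.
  move=> Q12 /LS[[Q1x _] Q1S] /LS[[_ nU] Q2S] /eqP nQ.
  have [Q1F l1 Q1m] := mem_sparse _ Q1S; have [Q2F l2 _] := mem_sparse _ Q2S.
  have lt := Q1m _ Q2F Q12 (nesym nQ) l2.
  have le : lam Q1 <= a * lam Q2.
    rewrite leNgt; apply/negP => lt12; apply: nU; apply/bigUP; exists Q1 => //.
    by rewrite mem_filter Q1F lt12 !andbT; apply/asboolP.
  by left; apply/le_anti; rewrite level_leD1//= lezD1.
(* Any two members at [x] have levels differing by exactly one, which three integers cannot do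
   pairwise. *)
case: L uL {LS} H => [|A [|B [|C L]]]// uL H; exfalso.
have AB : A != B by apply: contraTneq uL => ->; rewrite !cons_uniq !inE eqxx.
have AC : A != C by apply: contraTneq uL => ->; rewrite !cons_uniq !inE eqxx ?orbT.
have BC : B != C by apply: contraTneq uL => ->; rewrite !cons_uniq !inE eqxx ?andbF.
have := H A B; have := H A C; have := H B C; rewrite !inE !eqxx ?orbT.
by move=> /(_ isT isT BC) h1 /(_ isT isT AC) h2 /(_ isT isT AB) h3; lia.
Qed.

(** The constant 4 is 2 for the half volume kept by each part, times 2 for the overlap of the parts.
    [N] stands for the maximal function of a localized weight. [D] may exceed [M], as a closed cube
    exceeds the half-open one. *)
Lemma sparse_packing (s : set T -> R) (D M : set T) (N : T -> \bar R) (c : R) :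
  (forall Q, Q \in F -> 0 <= s Q) ->
  M `<=` D ->
  (forall x, D x -> (0 <= N x)%E) ->
  (forall Q x, Q \in F -> Q `<=` M -> Q x -> ((s Q / v Q)%:E <= N x)%E) ->
  (\int[mu]_(x in D) N x <= c%:E)%E ->
  \sum_(Q <- S | `[< Q `<=` M >]) s Q <= 4 * c.
Proof.
move=> s0 MD N0 sN Nc.
pose L := [seq Q <- S | `[< Q `<=` M >] ].
have LF Q : Q \in L -> [/\ Q \in F, 0 < lam Q & Q `<=` M].
  by rewrite mem_filter => /andP[/asboolP QM /mem_sparse[]].
have q0 Q : Q \in F -> 0 <= s Q / v Q / 2.
  by move=> QF; rewrite !divr_ge0 ?s0// ltW// v0.
(* A measurable minorant of [N]: its integral can be computed termwise, and at each point at most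
   two terms, each at most half of [N x], are present. *)
pose k x := (\sum_(Q <- L) (s Q / v Q / 2)%:E * (\1_(E Q) x)%:E)%E.
have H1 : ((\sum_(Q <- L) s Q / 4)%:E <= \int[mu]_x k x)%E.
  rewrite ge0_integral_sum_seq; last 2 first.
  - move=> Q /LF[QF _ _]; apply: measurable_funeM; apply/measurable_EFinP.
    by apply: measurable_indic; exact: measurable_sparse_part.
  - by move=> Q x /LF[QF _ _]; rewrite -EFinM lee_fin mulr_ge0 ?q0.
  rewrite -sumEFin big_seq [leRHS]big_seq; apply: lee_sum => Q /LF[QF l0 _].
  rewrite ge0_integralZl_EFin ?q0//; last first.
    by apply/measurable_EFinP/measurable_indic; exact: measurable_sparse_part.
  rewrite integral_indic//; last exact: measurable_sparse_part.
  rewrite setIT.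
  have -> : (s Q / 4)%:E = ((s Q / v Q / 2)%:E * (v Q / 2)%:E)%E.
    by rewrite -EFinM; congr EFin; field; rewrite gt_eqF// v0.
  by apply: lee_wpmul2l; [rewrite lee_fin q0|exact: sparse_part_half].
have H2 : (\int[mu]_x k x <= \int[mu]_(x in D) N x)%E.
  rewrite [leRHS]integral_mkcond; apply: ge0_le_lower_integral => x _.
    rewrite /k big_seq; apply: sume_ge0 => Q /LF[QF _ _].
    by rewrite -EFinM lee_fin mulr_ge0// q0.
  have kE : k x = (\sum_(Q <- [seq Q <- L | `[< E Q x >] ]) (s Q / v Q / 2)%:E)%E.
    rewrite /k [RHS]big_filter [RHS]big_mkcond/=; apply: eq_bigr => Q _.
    rewrite indicE; case: asboolP => Ex; first by rewrite mem_set// mule1.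
    by rewrite memNset// mule0.
  pose K := [seq Q <- L | `[< E Q x >] ].
  have KL Q : Q \in K -> [/\ Q \in F, Q `<=` M & Q x].
    by rewrite mem_filter => /andP[/asboolP[Qx _] /LF[QF _ QM]].
  have sK : (size K <= 2)%N.
    apply: leq_trans (sparse_overlap x); rewrite /K /L -filter_predI.
    by rewrite !size_filter; apply: sub_count => Q /= /andP[].
  rewrite kE -/K sumEFin; case: (K) sK KL => [_ _|Q1 K' sK KL].
    by rewrite big_nil; apply: erestrict_ge0.
  have [_ Q1M Q1x] := KL Q1 (mem_head _ _).
  rewrite patchE mem_set; last exact/MD/Q1M.
  have hN Q : Q \in Q1 :: K' -> ((s Q / v Q)%:E <= N x)%E.
    by move=> /KL[QF QM Qx]; exact: sN.
  have Nx0 : (0 <= N x)%E by apply: N0; exact/MD/Q1M.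
  case: (N x) Nx0 hN => [y||]//; last by move=> _ _; rewrite leey.
  rewrite lee_fin => y0 hN; rewrite lee_fin big_seq.
  apply: (@le_trans _ _ (\sum_(Q <- Q1 :: K') y / 2)).
    rewrite big_seq; apply: ler_sum => Q /hN; rewrite lee_fin => h.
    by rewrite ler_wpM2r.
  rewrite big_const_seq count_predT iter_addr_0 -[_ *+ _]mulr_natr.
  apply: (@le_trans _ _ (y / 2 * 2%:R)); last by rewrite divfK.
  by apply: ler_wpM2l; rewrite ?divr_ge0// ler_nat.
have := le_trans H1 (le_trans H2 Nc); rewrite lee_fin -mulr_suml big_filter.
by rewrite ler_pdivrMr// mulrC.
Qed.

End sparse.

(** * Lebesgue measure of cubes *)

Section boxes.
Context {R : realType}.

Definition box n (B : 'I_n -> set (measurableTypeR R)) :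
    set (n.-tuple (measurableTypeR R)) :=
  [set x | forall i, B i (tnth x i)].

Lemma measurable_box n (B : 'I_n -> set (measurableTypeR R)) :
  (forall i, measurable (B i)) -> measurable (box n B).
Proof.
move=> mB; have -> : box n B = \bigcap_(i in setT) ((fun x => tnth x i) @^-1` B i).
  by apply/seteqP; split => x H i; [move=> _; exact: H|exact: H].
apply: fin_bigcap_measurable => // i _; rewrite -[X in measurable X]setTI.
exact: measurable_tnth.
Qed.

Lemma borel_lebesgue_box n (B : 'I_n -> set (measurableTypeR R)) :
  (forall i, measurable (B i)) ->
  (borel_lebesgue n (box n B) = \prod_(i < n) lebesgue_measure (B i))%E.
Proof.
elim: n B => [|n IH] B mB.
  by rewrite big_ord0 /= diracE mem_set// => -[].
rewrite big_ord_recl -IH//.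
have -> : borel_lebesgue n.+1 (box n.+1 B) =
   (lebesgue_measure \x borel_lebesgue n)%E (@tuple_cons R n @^-1` box n.+1 B) by [].
have -> : @tuple_cons R n @^-1` box n.+1 B = B ord0 `*` box n (fun i => B (lift ord0 i)).
  apply/seteqP; split => -[t x] /= H.
    split; first by have := H ord0; rewrite tnth0.
    by move=> i; have := H (lift ord0 i); rewrite tnthS.
  move: H => [H0 H] i; have [j ->|->] := unliftP ord0 i.
    by rewrite tnthS; exact: H.
  by rewrite tnth0.
by rewrite product_measure1E//; exact: measurable_box.
Qed.

End boxes.

Section cubes.
Context {R : realType} {n : nat}.
Implicit Types (a : 'I_n -> R) (l : R).

Definition closed_cube a l : set (Rn R n) :=
  [set x | forall i, a i <= tnth x i <= a i + l].

Definition half_cube a l : set (Rn R n) :=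
  [set x | forall i, a i <= tnth x i < a i + l].

Lemma half_cube_sub a l : half_cube a l `<=` closed_cube a l.
Proof. by move=> x H i; have /andP[-> /ltW] := H i. Qed.

Let measurable_lebesgue (A : set (n.-tuple (measurableTypeR R))) : measurable A ->
  measurable (A : set (Rn R n)) /\ lebesgue (A : set (Rn R n)) = borel_lebesgue n A.
Proof.
move=> mA; split; first exact: caratheodory_measurable_mu_ext.
exact: measurable_mu_extE.
Qed.

Let prod_itv (B : 'I_n -> set (measurableTypeR R)) (l : R) :
  (forall i, measurable (B i)) -> (forall i, lebesgue_measure (B i) = l%:E) ->
  measurable (box n B : set (Rn R n)) /\ lebesgue (box n B : set (Rn R n)) = (l ^+ n)%:E.
Proof.
move=> mB lB; have [mb ->] := measurable_lebesgue _ (measurable_box n B mB).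
split => //; rewrite borel_lebesgue_box//.
under eq_bigr do rewrite lB.
by rewrite prodEFin prodr_const card_ord.
Qed.

Lemma closed_cube_lebesgue a l : 0 < l ->
  measurable (closed_cube a l) /\ lebesgue (closed_cube a l) = (l ^+ n)%:E.
Proof.
move=> l0.
have -> : closed_cube a l = box n (fun i => `[a i, a i + l]%classic).
  by apply/seteqP; split => x H i; have := H i; rewrite /= in_itv.
apply: prod_itv => i; first exact: measurable_itv.
by rewrite lebesgue_measure_itv/= lte_fin ltrDl l0 -EFinB addrAC subrr add0r.
Qed.

Lemma half_cube_lebesgue a l : 0 < l ->
  measurable (half_cube a l) /\ lebesgue (half_cube a l) = (l ^+ n)%:E.
Proof.
move=> l0.
have -> : half_cube a l = box n (fun i => `[a i, a i + l[%classic).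
  by apply/seteqP; split => x H i; have := H i; rewrite /= in_itv.
apply: prod_itv => i; first exact: measurable_itv.
by rewrite lebesgue_measure_itv/= lte_fin ltrDl l0 -EFinB addrAC subrr add0r.
Qed.

(** The difference of the two cubes is null because both have the same finite volume [l ^ n], which
    cancels. *)
Lemma half_cube_integral a l (f : Rn R n -> \bar R) : 0 < l ->
  measurable_fun setT f -> (forall x, (0 <= f x)%E) ->
  (\int[lebesgue]_(x in half_cube a l) f x = \int[lebesgue]_(x in closed_cube a l) f x)%E.
Proof.
move=> l0 mf f0; have [mc lc] := closed_cube_lebesgue a l l0.
have [mh lh] := half_cube_lebesgue a l l0.
have hE : closed_cube a l `&` half_cube a l = half_cube a l.
  by apply/setIidPr; exact: half_cube_sub.
rewrite [RHS](@ge0_negligible_integral _ _ _ _ _ (closed_cube a l `\` half_cube a l))//.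
- by rewrite setDD hE.
- exact: measurableD.
- exact: measurable_funS mf.
- have : (lebesgue (closed_cube a l) = lebesgue (closed_cube a l `\` half_cube a l) +
     lebesgue (closed_cube a l `&` half_cube a l))%E by exact: measureDI.
  have cancel (z : \bar R) : ((l ^+ n)%:E = z + (l ^+ n)%:E -> z = 0)%E.
    case: z => //= z; rewrite -EFinD => -[] H; congr EFin.
    by apply: (addIr (l ^+ n)); rewrite add0r -H.
  by rewrite hE lc lh; exact: cancel.
Qed.

Lemma closed_cube_compact a l : compact (row_of @` closed_cube a l).
Proof.
have -> : row_of @` closed_cube a l =
    [set v : 'rV[R]_n | forall i, `[a i, a i + l]%classic (v ord0 i)].
  apply/seteqP; split => [_ [x H <-] i|v H]; first by rewrite /row_of mxE/= in_itv; exact: H.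
  exists [tuple v ord0 i | i < n].
    by move=> i; rewrite tnth_mktuple; have := H i; rewrite /= in_itv.
  by apply/rowP => i; rewrite mxE tnth_mktuple.
by apply: (@rV_compact _ _ (fun i => `[a i, a i + l]%classic)) => i; exact: segment_compact.
Qed.

Lemma loc_integrable_cube (f : Rn R n -> R) a l : loc_integrable f ->
  (forall x, 0 <= f x) ->
  (\int[lebesgue]_(x in closed_cube a l) (f x)%:E < +oo)%E.
Proof.
move=> [mf fi] f0; apply: le_lt_trans (fi _ (closed_cube_compact a l)).
by apply: ge0_le_lower_integral => x _; rewrite lee_fin// ler_norm.
Qed.

End cubes.

(** * Shifted dyadic grids *)

(** The endpoints of both intervals lie at integer multiples of [s] from [h]. The common point [x]
    gives strict inequalities between endpoints, and over the integers these improve by one unit to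
    the inclusion. *)
Lemma nested_itv {R : realType} (h x y s : R) (c : nat) (i j : int) : 0 < s ->
  h + j%:~R * s <= x < h + j%:~R * s + s ->
  h + i%:~R * (s * c%:Z%:~R) <= x < h + i%:~R * (s * c%:Z%:~R) + s * c%:Z%:~R ->
  h + j%:~R * s <= y < h + j%:~R * s + s ->
  h + i%:~R * (s * c%:Z%:~R) <= y < h + i%:~R * (s * c%:Z%:~R) + s * c%:Z%:~R.
Proof.
move=> s0 /andP[x1 x2] /andP[x3 x4] /andP[y1 y2].
have lt1 : i%:~R * (s * c%:Z%:~R) < j%:~R * s + s by lra.
have lt2 : j%:~R * s < i%:~R * (s * c%:Z%:~R) + s * c%:Z%:~R by lra.
have le1 : i%:~R * (s * c%:Z%:~R) <= j%:~R * s.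
  have : i * c%:Z <= j.
    rewrite -ltzD1 -(ltr_int R) intrD intrM -(ltr_pM2r s0).
    by rewrite mulrDl mul1r -mulrA [_ * s]mulrC.
  by rewrite -(ler_int R) intrM -(ler_pM2r s0) -mulrA [_ * s in X in X -> _]mulrC.
have le2 : j%:~R * s + s <= i%:~R * (s * c%:Z%:~R) + s * c%:Z%:~R.
  have : j + 1 <= (i + 1) * c%:Z.
    rewrite lezD1 -(ltr_int R) intrM intrD -(ltr_pM2r s0) mulrDl mul1r mulrDl.
    by rewrite -mulrA [c%:Z%:~R * s]mulrC.
  rewrite -(ler_int R) intrM !intrD -(ler_pM2r s0) !(mulrDl, mul1r).
  by rewrite -mulrA [c%:Z%:~R * s]mulrC.
by apply/andP; split; lra.
Qed.

Section grid.
Context {R : realType} {n : nat}.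

(* The grids are anchored at their top scale 2^r and only have meshes 2^(r-k): they are
   nested for trivial reasons, and letting r tend to infinity exhausts all cubes. *)
Definition grid_shift (r : nat) (b : bool) : R := if b then 2 ^+ r / 3 else 0.

Definition grid_cube r (t : 'I_n -> bool) (k : nat) (j : 'I_n -> int) : set (Rn R n) :=
  half_cube (fun i => grid_shift r (t i) + (j i)%:~R * (2 ^+ r / 2 ^+ k)) (2 ^+ r / 2 ^+ k).

Lemma grid_nested r t k k' j j' x : (k <= k')%N ->
  grid_cube r t k j x -> grid_cube r t k' j' x ->
  grid_cube r t k' j' `<=` grid_cube r t k j.
Proof.
move=> kk' Qx Q'x y Q'y i; have := Q'y i; have := Qx i; have := Q'x i.
rewrite -(subnKC kk'); set e := (k' - k)%N.
set s' := 2 ^+ r / _ : R; set s := 2 ^+ r / _ : R; set h := grid_shift _ _.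
have s'0 : 0 < s' by rewrite divr_gt0// exprn_gt0.
have sE : s = s' * ((2 ^ e)%N%:Z)%:~R.
  by rewrite /s /s' exprD -pmulrn natrX invfM mulrA divfK// expf_neq0.
move=> Q'xi Qxi Q'yi; rewrite sE; apply: (nested_itv _ _ _ _ _ _ _ s'0 _ _ Q'yi).
  exact: Q'xi.
by move: Qxi; rewrite sE.
Qed.

(** Meshes run from 2^r down to 2^(-r) and indices from -4^r to 4^r: even at the smallest mesh the
    window has radius about 2^r, so every cube is eventually reached. *)
Definition grid_family r (t : 'I_n -> bool) : seq (set (Rn R n)) :=
  [seq grid_cube r t k (fun i => (z i)%:Z - (4 ^ r)%N%:Z) |
    k : nat <- iota 0 (2 * r).+1, z : {ffun 'I_n -> 'I_(2 * 4 ^ r).+1} <- enum {: {ffun 'I_n -> 'I_(2 * 4 ^ r).+1}} ].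

Lemma grid_family_laminar r t : laminar (grid_family r t).
Proof.
move=> A B /allpairsP[[k j] [/= _ _ ->]] /allpairsP[[k' j'] [/= _ _ ->]].
set Q := grid_cube _ _ _ _; set Q' := grid_cube _ _ _ _.
have [[x [Qx Q'x]]|nQ] := pselect (exists x, Q x /\ Q' x); last first.
  right; right; apply/seteqP; split => // x [Qx Q'x]; apply: nQ.
  by exists x.
case/orP: (leq_total k k') => kk'.
- by right; left; exact: (grid_nested _ _ _ _ _ _ _ kk' Qx Q'x).
- by left; exact: (grid_nested _ _ _ _ _ _ _ kk' Q'x Qx).
Qed.

Lemma grid_family_cube r t Q : Q \in grid_family r t ->
  exists a l, 0 < l /\ Q = half_cube a l.
Proof.
move=> /allpairsP[[k j] [/= _ _ ->]]; eexists; eexists; split; last by [].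
by rewrite divr_gt0// exprn_gt0.
Qed.

(* One third of a power of two is at distance at least 1/3 from the integers, so an
   interval shorter than a third of the mesh cannot meet the endpoints of both grids. *)
Lemma grid_shift_cover r k (a l : R) : 0 <= l ->
  3 * l < 2 ^+ r / 2 ^+ k ->
  exists b (j : int), grid_shift r b + j%:~R * (2 ^+ r / 2 ^+ k) <= a /\
    a + l < grid_shift r b + j%:~R * (2 ^+ r / 2 ^+ k) + 2 ^+ r / 2 ^+ k.
Proof.
move=> l0 ls; set s := 2 ^+ r / _ in ls *.
have s0 : 0 < s by rewrite divr_gt0// exprn_gt0.
have fl (y : R) : exists j : int, j%:~R * s <= y /\ y < j%:~R * s + s.
  exists (Num.floor (y / s)); rewrite -ler_pdivlMr// floor_le; split => //.
  by have := floorD1_gt (y / s); rewrite ltr_pdivrMr// intrD mulrDl mul1r.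
have [j0 [j01 j02]] := fl a.
have [lt0|ge0] := ltP (a + l) (j0%:~R * s + s).
  by exists false, j0; rewrite /grid_shift !add0r.
have [j1 [j11 j12]] := fl (a - 2 ^+ r / 3).
exists true, j1; rewrite /grid_shift; split; first by lra.
rewrite ltNge; apply/negP => ge1.
have rE : 2 ^+ r = s * ((2 ^ k)%N%:Z)%:~R :> R.
  by rewrite -pmulrn natrX divfK// expf_neq0.
rewrite rE in j11 j12 ge1.
have K3 : ~ (3 * (j1 - j0) + (2 ^ k)%N%:Z = 0).
  move=> E; have : (3 %| 2 ^ k)%N by clear -E; lia.
  by rewrite Euclid_dvdX.
clear rE; move: K3; set z := (2 ^ k)%N%:Z in j11 j12 ge1 *; move=> K3.
have wE : (3 * (j1 - j0) + z)%:~R * s =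
    3 * (j1%:~R * s) - 3 * (j0%:~R * s) + s * z%:~R by ring.
have r1 : 3 * (j1%:~R * s) - 3 * (j0%:~R * s) + s * z%:~R < s by lra.
have r2 : - s < 3 * (j1%:~R * s) - 3 * (j0%:~R * s) + s * z%:~R by lra.
have lt1 : 3 * (j1 - j0) + z < 1.
  by rewrite -(ltr_int R) -(ltr_pM2r s0) wE mul1r.
have lt2 : -1 < 3 * (j1 - j0) + z.
  by rewrite -(ltr_int R) -(ltr_pM2r s0) wE mulN1r.
by clear -K3 lt1 lt2; lia.
Qed.

(** There is a power of two [s] with 3l < s <= 6l, and [grid_shift_cover] applies at this mesh in
    each coordinate. Each coordinate chooses its own shift, hence the 2^n grids. *)
Lemma grid_cover (a : 'I_n -> R) (l : R) : 0 < l ->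
  exists r0, forall r, (r0 <= r)%N -> exists t : {ffun 'I_n -> bool},
  exists Q, [/\ Q \in grid_family r t, closed_cube a l `<=` Q &
    exists b s, [/\ 0 < s, s <= 6 * l & Q = half_cube b s] ].
Proof.
move=> l0; have l30 : 0 < 3 * l by rewrite mulr_gt0.
have [N HN] := dyadic_levels_exist [:: 3 * l].
have [k _ /andP[kl lk]] := dyadic_level _ _ (HN _ (mem_head _ _) l30).
set s := 2 ^+ k.+1 / 2 ^+ N in lk.
have s0 : 0 < s by rewrite divr_gt0// exprn_gt0.
have s6 : s <= 6 * l.
  by rewrite /s exprS -mulrA; move: kl; set y := _ / _; lra.
(* The condition [z i <= 2 ^+ r], multiplied by s 2^r, shows that |a i|, a shift of at most 2^r and
   one mesh together stay below 4^r s. This confines the index to the window. *)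
pose z i := (1 + `|a i|) / s + 1.
have z0 i : 0 < z i by rewrite addr_gt0// divr_gt0// ltr_pwDl.
have [N' HN'] := dyadic_levels_exist [seq z i | i <- enum 'I_n].
exists (maxn k.+1 (maxn N N')) => r; rewrite !geq_max => /and3P[kr Nr N'r].
(* The depth at which the grid with top scale 2^r has mesh 2^(k+1-N) = [s]. *)
pose K := (r + N - k.+1)%N.
have sE : 2 ^+ r / 2 ^+ K = s.
  apply/eqP; rewrite eqr_div ?expf_neq0// -!exprD; apply/eqP; congr (_ ^+ _).
  by rewrite /K; lia.
have H i : exists bj : bool * int, grid_shift r bj.1 + bj.2%:~R * s <= a i /\
    a i + l < grid_shift r bj.1 + bj.2%:~R * s + s.
  have [|b [j bj]] := grid_shift_cover r K (a i) l (ltW l0); first by rewrite sE.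
  by exists (b, j); rewrite -sE.
have {H}[bj Hbj] := choice H.
have zr i : z i <= 2 ^+ r.
  have /andP[_ /ltW h] := HN' (z i) (map_f _ (mem_enum _ i)) (z0 i).
  by apply: (le_trans h); rewrite ler_weXn2l// ler1n.
have jr i : (`|(bj i).2| <= 4 ^ r)%N.
  have [h1 h2] := Hbj i.
  have h0 : 0 <= grid_shift r (bj i).1 :> R.
    by rewrite /grid_shift; case: ifP => // _; rewrite divr_ge0// exprn_ge0.
  have h3 : grid_shift r (bj i).1 <= 2 ^+ r :> R.
    rewrite /grid_shift; case: ifP => _; last exact: exprn_ge0.
    by rewrite ler_pdivrMr// ler_peMr ?exprn_ge0// ler1n.
  have p1 : 1 <= 2 ^+ r :> R by rewrite exprn_ege1// ler1n.
  have bound : (1 + `|a i|) * 2 ^+ r + s * 2 ^+ r <= (2 ^+ r * 2 ^+ r) * s.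
    have := zr i; rewrite /z -(ler_pM2r s0) mulrDl divfK ?gt_eqF// mul1r => h.
    rewrite -mulrDl -mulrA [2 ^+ r * s]mulrC mulrA ler_pM2r ?exprn_gt0//.
  have a0 : `|a i| <= `|a i| * 2 ^+ r by rewrite ler_peMr.
  have sr : s <= s * 2 ^+ r by rewrite ler_peMr// ltW.
  have na := ler_norm (a i); have nna := ler_norm (- a i); rewrite normrN in nna.
  have E4 : (2 ^+ r * 2 ^+ r : R) = (4 ^ r)%N%:R by rewrite natrX -exprMn -natrM.
  have n0 := normr_ge0 (a i).
  rewrite E4 in bound.
  have u1 : (bj i).2%:~R * s <= (4 ^ r)%N%:R * s by lra.
  have u2 : - ((4 ^ r)%N%:R * s) <= (bj i).2%:~R * s by lra.
  rewrite -mulNr !ler_pM2r// in u1 u2.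
  rewrite -lez_nat abszE ler_norml -!(ler_int R) intrN -!pmulrn.
  by apply/andP.
exists [ffun i => (bj i).1].
exists (grid_cube r [ffun i => (bj i).1] K (fun i => (bj i).2)); split.
- apply/allpairsP.
  have zl i : (absz ((bj i).2 + (4 ^ r)%N%:Z)%R < (2 * 4 ^ r).+1)%N.
    by have := jr i; lia.
  have Ki : K \in iota 0 (2 * r).+1 by rewrite mem_iota /K; lia.
  exists (K, [ffun i => Ordinal (zl i)]); split => //; first by rewrite mem_enum.
  congr grid_cube; apply/funext => i; rewrite ffunE/=.
  by have := jr i; clear -i; lia.
- move=> x Hx i; have [h1 h2] := Hbj i; rewrite sE ffunE.
  have /andP[x1 x2] := Hx i; apply/andP; split; first exact: le_trans x1.
  exact: le_lt_trans h2.
- eexists; exists (2 ^+ r / 2 ^+ K); split; [by rewrite sE|by rewrite sE|by []].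
Qed.

End grid.

(** * Dual weights and maximal functions on cubes *)

Section dual_density.
Context {d} {T : measurableType d} {R : realType}.
Variable mu : {measure set T -> \bar R}.
Variables (p : R) (w f : T -> R).
Hypothesis p1 : 1 < p.
Hypotheses (mf : measurable_fun setT f) (mw : measurable_fun setT w).
Hypothesis w0 : {ae mu, forall x, 0 < w x}.

Let p0 : 0 < p. Proof. exact: lt_trans p1. Qed.

Definition dual_power x := w x `^ (- conjugate p).

(** The density of |f| dx with respect to sigma dx. Where [w] vanishes the quotient is 0 by
    convention, which only concerns a null set. *)
Definition dual_density x := `|f x| / dual_power x.

Local Notation sigma := dual_power.
Local Notation density := dual_density.

Lemma dual_power_ge0 x : 0 <= sigma x.
Proof. exact: powR_ge0. Qed.

Lemma measurable_dual_power : measurable_fun setT sigma.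
Proof. exact: measurableT_comp (measurable_powR _) mw. Qed.

Lemma dual_density_ge0 x : 0 <= density x.
Proof. by apply: divr_ge0 => //; exact: dual_power_ge0. Qed.

Lemma conjugate_mulB : conjugate p * (p - 1) = p.
Proof.
have h : p - 1 != 0 by rewrite subr_eq0 gt_eqF.
by rewrite /conjugate; field; rewrite gt_eqF.
Qed.

Lemma measurable_dual_density : measurable_fun setT density.
Proof.
apply: measurable_funM; first exact: measurableT_comp mf.
rewrite (_ : (fun x => _) = fun x => w x `^ (conjugate p)).
  exact: measurableT_comp (measurable_powR _) mw.
by apply/funext => x; rewrite /dual_power powRN invrK.
Qed.

Let measurable_densityM : measurable_fun setT (fun x => density x * sigma x).
Proof.
by apply: measurable_funM; [exact: measurable_dual_density|exact: measurable_dual_power].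
Qed.

Let measurable_densityX : measurable_fun setT (fun x => density x `^ p * sigma x).
Proof.
apply: measurable_funM; last exact: measurable_dual_power.
exact: measurableT_comp (measurable_powR _) measurable_dual_density.
Qed.

Lemma integral_dual_density (D : set T) : measurable D ->
  (\int[mu]_(x in D) (density x * sigma x)%:E = \int[mu]_(x in D) `|f x|%:E)%E.
Proof.
move=> mD; apply: ge0_ae_eq_integral => //.
- exact/measurable_EFinP/measurable_funTS.
- by apply/measurable_EFinP/measurable_funTS; exact: measurableT_comp mf.
- by move=> x _; rewrite lee_fin mulr_ge0 ?dual_density_ge0 ?dual_power_ge0.
- apply: filterS w0 => x wx _.
  by rewrite /dual_density divfK// gt_eqF// powR_gt0.
Qed.

(** With density |f| w^(p'), the weight appears with the exponent p'p - p' = p'(p - 1) = p. *)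
Lemma integral_dual_density_powR :
  (\int[mu]_x (density x `^ p * sigma x)%:E =
   \int[mu]_x (`|f x| `^ p * w x `^ p)%:E)%E.
Proof.
apply: (ge0_ae_eq_integral measurableT).
- exact/measurable_EFinP.
- apply/measurable_EFinP/measurable_funM; last first.
    exact: measurableT_comp (measurable_powR _) mw.
  by apply: measurableT_comp (measurable_powR _) _; exact: measurableT_comp mf.
- by move=> x _; rewrite lee_fin mulr_ge0 ?powR_ge0.
- by move=> x _; rewrite lee_fin mulr_ge0 ?powR_ge0.
- apply: filterS w0 => x wx _; congr EFin.
  rewrite /dual_density /dual_power powRN invrK powRM ?powR_ge0// -mulrA.
  congr (_ * _); rewrite -powRrM -powRN -powRD; last by rewrite (gt_eqF wx) implybT.
  by congr (_ `^ _); rewrite -[RHS]conjugate_mulB mulrBr mulr1.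
Qed.

(** A zero integral would force sigma = 0 a.e. on [D], against w > 0 a.e. This is what allows
    averages with respect to sigma. *)
Lemma integral_dual_power_gt0 (D : set T) : measurable D -> (0 < mu D)%E ->
  (0 < \int[mu]_(x in D) (sigma x)%:E)%E.
Proof.
move=> mD muD.
have s0 : (0 <= \int[mu]_(x in D) (sigma x)%:E)%E.
  by apply: integral_ge0 => x _; rewrite lee_fin dual_power_ge0.
rewrite lt_neqAle s0 andbT eq_sym; apply/eqP => int0.
have ms : measurable_fun D (EFin \o sigma).
  apply/measurable_EFinP; apply: measurable_funTS; exact: measurable_dual_power.
have : (\int[mu]_(x in D) `|(EFin \o sigma) x| = 0)%E.
  rewrite -int0; apply: eq_integral => x _ /=.
  by rewrite ger0_norm// dual_power_ge0.
move=> /(ae_eq_integral_abs mu mD ms) sig0.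
have : mu.-negligible D.
  have : \forall x \ae mu, ~ D x.
    apply: filterS2 w0 sig0 => x wx H hx.
    have /= := H hx; case => E; have := powR_gt0 (- conjugate p) wx.
    by rewrite -/(dual_power x) E ltxx.
  by move=> H; rewrite -[D]setCK; exact: H.
by move=> /(negligibleP mu mD) D0; move: muD; rewrite D0 ltxx.
Qed.

(** The pointwise bound g <= 1 + g^p, integrated against sigma, makes |f| integrable on cubes. *)
Lemma integral_dual_density_lty (D : set T) : measurable D ->
  (\int[mu]_(x in D) (sigma x)%:E < +oo)%E ->
  (\int[mu]_x (density x `^ p * sigma x)%:E < +oo)%E ->
  (\int[mu]_(x in D) `|f x|%:E < +oo)%E.
Proof.
move=> mD sD dD; have s0 := dual_power_ge0; have d0 := dual_density_ge0.
rewrite -integral_dual_density//.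
apply: (@le_lt_trans _ _ (\int[mu]_(x in D)
   ((sigma x)%:E + (density x `^ p * sigma x)%:E))%E).
  apply: ge0_le_lower_integral => x _; first by rewrite lee_fin mulr_ge0.
  rewrite -EFinD lee_fin -{2}[sigma x]mul1r -mulrDl ler_wpM2r//.
  have [d1|d1] := leP (density x) 1; first by rewrite ler_wpDr// powR_ge0.
  by rewrite ler_wpDl// le1r_powR// ltW.
rewrite ge0_integralD//; last 4 first.
- by move=> x _; rewrite lee_fin.
- by apply/measurable_EFinP; apply: measurable_funTS; exact: measurable_dual_power.
- by move=> x _; rewrite lee_fin mulr_ge0 ?powR_ge0.
- exact/measurable_EFinP/measurable_funTS.
apply: lte_add_pinfty => //; apply: le_lt_trans dD.
apply: ge0_subset_integral => //; first exact/measurable_EFinP.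
by move=> x _; rewrite lee_fin mulr_ge0 ?powR_ge0.
Qed.

End dual_density.

Lemma integral_indic_mul_le {d} {T : measurableType d} {R : realType}
    (mu : {measure set T -> \bar R}) (w : T -> R) (A C E : set T) :
  measurable_fun setT w -> (forall x, 0 <= w x) ->
  measurable A -> measurable C -> measurable E -> A `<=` C -> A `<=` E ->
  (\int[mu]_(x in A) (w x)%:E <= \int[mu]_(x in C) `|w x * \1_E x|%:E)%E.
Proof.
move=> mw w0 mA mC mE AC AE.
apply: (@le_trans _ _ (\int[mu]_(x in A) `|w x * \1_E x|%:E)%E).
  apply: ge0_le_lower_integral => z Az; first by rewrite lee_fin.
  by rewrite indicE mem_set ?mulr1 ?ger0_norm//; exact: AE.
apply: ge0_subset_integral => //.
apply/measurable_EFinP/measurable_funTS; apply: measurableT_comp => //.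
by apply: measurable_funM => //; exact: measurable_indic.
Qed.

Lemma wnorm_powR {R : realType} {n} (p N : R) (v f : Rn R n -> R) : 0 < p ->
  (forall x, 0 <= v x) -> wnorm p v (EFin \o f) = N%:E ->
  (\int[lebesgue]_x (`|f x| `^ p * v x)%:E = (N `^ p)%:E)%E.
Proof.
move=> p0 v0; rewrite /wnorm => /(congr1 (fun z => z `^ p)%E).
rewrite -poweRrM mulVf ?gt_eqF// poweRe1; last first.
  apply: integral_ge0 => x _; apply: mule_ge0; first exact: poweR_ge0.
  by rewrite lee_fin.
by move=> H; rewrite -poweR_EFin -H; apply: eq_integral => x _; rewrite /= EFinM.
Qed.

Section maximal_cube.
Context {R : realType} {n : nat}.
Variables (w : Rn R n -> R).
Hypothesis mw : measurable_fun setT w.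
Hypothesis w0 : forall x, 0 <= w x.
Implicit Types (a b : 'I_n -> R) (l s : R).

(** Since [maximal] ranges over closed cubes, the competitor is [closed_cube b s]. It has the volume
    of the half-open cube and at least its integral, the indicator being 1 on the half-open cube. *)
Lemma average_le_maximal a l b s x (v y : R) : 0 < l -> 0 < s ->
  half_cube b s `<=` half_cube a l -> half_cube b s x ->
  lebesgue (half_cube b s) = v%:E ->
  (\int[lebesgue]_(x in half_cube b s) (w x)%:E = y%:E)%E ->
  ((y / v)%:E <= maximal (fun y => w y * \1_(closed_cube a l) y)%R x)%E.
Proof.
move=> l0 s0 sub xb vE yE.
have [mh lh] := half_cube_lebesgue b s s0; have [mc lc] := closed_cube_lebesgue b s s0.
have [ma _] := closed_cube_lebesgue a l l0.
have vp : v != 0 by move: vE; rewrite lh => -[<-]; rewrite expf_neq0 ?gt_eqF.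
set g := fun y => (w y * \1_(closed_cube a l) y)%R.
have g0 z : 0 <= g z by rewrite mulr_ge0.
apply: (@le_trans _ _ (average (fun y => `|g y|) (closed_cube b s))); last first.
  apply: ereal_sup_ubound; exists (closed_cube b s) => //; split.
    by exists b, s.
  exact: half_cube_sub.
have v0 : 0 < v by move: vE; rewrite lh => -[<-]; rewrite exprn_gt0.
rewrite /average lc -lh vE inver (negPf vp) mulrC EFinM -yE.
apply: lee_wpmul2l; first by rewrite lee_fin invr_ge0 ltW.
by apply: integral_indic_mul_le => //; [exact: half_cube_sub|exact: subset_trans (half_cube_sub _ _)].
Qed.

Lemma Ainfty_cube (X y : R) a l : 0 < l -> Ainfty_const w = X%:E ->
  0 < y -> (\int[lebesgue]_(x in closed_cube a l) (w x)%:E = y%:E)%E ->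
  (\int[lebesgue]_(x in closed_cube a l)
     maximal (fun y => w y * \1_(closed_cube a l) y)%R x <= (X * y)%:E)%E.
Proof.
move=> l0 XE y0 yE; set J := (\int[lebesgue]_(x in _) maximal _ x)%E.
have : (y^-1%:E * J <= X%:E)%E.
  rewrite -XE -[X in (X * _)%E](_ : (y%:E)^-1%E = _); last by rewrite inver gt_eqF.
  rewrite -yE; apply: ereal_sup_ubound.
  by exists (closed_cube a l) => //; exists a, l.
by rewrite muleC lee_pdivrMr// -EFinM.
Qed.

End maximal_cube.

(** * The two-weight bound *)

Lemma powR_prod {R : realType} {I : finType} (x : I -> R) (r : R) :
  (forall i, 0 <= x i) -> (\prod_i x i) `^ r = \prod_i x i `^ r.
Proof.
move=> x0; suff [] : 0 <= \prod_i x i /\ (\prod_i x i) `^ r = \prod_i x i `^ r by [].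
apply: (big_ind2 (fun a b => 0 <= a /\ a `^ r = b)).
- by rewrite powR1.
- by move=> a b c d [a0 <-] [c0 <-]; rewrite mulr_ge0// powRM.
- by move=> i _; rewrite x0.
Qed.

Lemma powR_sum {R : realType} {I : finType} (x : R) (r : I -> R) : x != 0 ->
  x `^ (\sum_i r i) = \prod_i x `^ r i.
Proof.
move=> x0; apply: (big_morph (fun r => x `^ r)); last by rewrite powRr0.
by move=> a b; rewrite powRD// x0 implybT.
Qed.

Lemma powR_inv {R : realType} (x r : R) : 0 <= x -> x^-1 `^ r = (x `^ r)^-1.
Proof. by move=> x0; rewrite -powR_inv1// -powRrM mulN1r powRN. Qed.

Lemma conjugateV {R : realType} (p : R) : (conjugate p)^-1 = 1 - p^-1.
Proof. by rewrite /conjugate invrK. Qed.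

(** After taking q-th roots, the left side equals the A_(P,q) expression of the cube times the
    product of (phi/s) s^(1/P): the powers of [s] cancel, and those of [v] do because the 1/P i add
    up to 1/p. *)
Lemma testing_cube_powR {R : realType} (m : nat) (P : 'I_m -> R) (p q beta v U K : R)
    (s phi : 'I_m -> R) :
  (forall i, 1 < P i) -> \sum_(i < m) (P i)^-1 = p^-1 -> 0 < q ->
  0 < v -> 0 <= U -> (forall i, 0 < s i) -> (forall i, 0 <= phi i) ->
  v `^ (beta + q^-1 - p^-1) * (v^-1 * U) `^ q^-1 *
    \prod_(i < m) (v^-1 * s i) `^ (conjugate (P i))^-1 <= K ->
  (v `^ beta * \prod_(i < m) (phi i / v)) `^ q * U <=
  K `^ q * \prod_(i < m) ((phi i / s i) `^ P i * s i) `^ (q / P i).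
Proof.
move=> P1 hp q0 v0 U0 s0 phi0 HK.
have P0 i : 0 < P i by exact: lt_trans (P1 i).
have v_neq0 : v != 0 by rewrite gt_eqF.
have lam0 : 0 <= v `^ beta * \prod_(i < m) (phi i / v).
  by rewrite mulr_ge0 ?powR_ge0// prodr_ge0// => i _; rewrite divr_ge0// ltW.
have a0 i : 0 <= (phi i / s i) `^ P i * s i by rewrite mulr_ge0 ?powR_ge0// ltW.
have K0 : 0 <= K.
  apply: le_trans HK; rewrite !mulr_ge0 ?powR_ge0// prodr_ge0// => i _.
  exact: powR_ge0.
have -> : \prod_(i < m) ((phi i / s i) `^ P i * s i) `^ (q / P i) =
    (\prod_(i < m) (phi i / s i * s i `^ (P i)^-1)) `^ q.
  rewrite powR_prod => [|i]; last by rewrite mulr_ge0 ?powR_ge0// divr_ge0// ltW.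
  apply: eq_bigr => i _; rewrite [q / P i]mulrC powRrM; congr (_ `^ q).
  rewrite powRM ?powR_ge0//; last exact: ltW.
  by rewrite -powRrM divff ?gt_eqF// powRr1// divr_ge0// ltW.
have b0 : 0 <= \prod_(i < m) (phi i / s i * s i `^ (P i)^-1).
  by rewrite prodr_ge0// => i _; rewrite mulr_ge0 ?powR_ge0// divr_ge0// ltW.
rewrite -powRM//.
have -> : U = (U `^ q^-1) `^ q by rewrite -powRrM mulVf ?gt_eqF// powRr1.
rewrite -powRM ?powR_ge0//; apply: ge0_ler_powR; rewrite ?nnegrE.
- exact: ltW.
- by rewrite mulr_ge0// powR_ge0.
- by rewrite mulr_ge0.
apply: le_trans (ler_wpM2r b0 HK); rewrite le_eqVlt; apply/orP; left; apply/eqP.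
rewrite -[RHS]mulrA -big_split/=.
have -> : \prod_(i < m) ((v^-1 * s i) `^ (conjugate (P i))^-1 *
      (phi i / s i * s i `^ (P i)^-1)) =
    \prod_(i < m) (phi i / v) * v `^ p^-1.
  rewrite -hp powR_sum// -big_split/=; apply: eq_bigr => i _.
  have si := s0 i; have sn : s i != 0 by rewrite gt_eqF.
  have vs0 : 0 < v^-1 * s i by rewrite mulr_gt0// invr_gt0.
  rewrite conjugateV powRB ?(gt_eqF vs0) ?implybT// powRr1 ?(ltW vs0)//.
  rewrite powRM ?invr_ge0 ?(ltW v0) ?(ltW si)//.
  rewrite powR_inv ?(ltW v0)//.
  have x0 := powR_gt0 ((P i)^-1) v0; have y0 := powR_gt0 ((P i)^-1) si.
  move: (v `^ _) (s i `^ _) x0 y0 => x y x0 y0.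
  by field; rewrite v_neq0 sn !gt_eqF.
rewrite powRM ?invr_ge0 ?(ltW v0)//.
rewrite powR_inv ?(ltW v0)//.
rewrite !powRD ?powRN; last 2 first.
- by rewrite v_neq0 implybT.
- by rewrite v_neq0 implybT.
have := powR_gt0 (q^-1) v0; have := powR_gt0 (p^-1) v0.
set x := v `^ q^-1; set y := v `^ p^-1 => y0 x0.
by field; rewrite !gt_eqF.
Qed.





(** * Limits inferior, dilation of cubes, and positivity of the constants *)

Lemma limn_einf_ge {R : realType} (v : (\bar R)^nat) (c : \bar R) r0 :
  (forall r, (r0 <= r)%N -> (c <= v r)%E) -> (c <= limn_einf v)%E.
Proof.
move=> cv; rewrite limn_einf_lim; apply: lime_ge; first exact: is_cvg_einfs.
exists r0 => // r /= r0r; apply: le_ereal_inf_tmp => _ [k /= rk <-].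
by apply: cv; exact: leq_trans rk.
Qed.

Lemma limn_einf_le {R : realType} (v : (\bar R)^nat) (c : \bar R) :
  (forall r, (v r <= c)%E) -> (limn_einf v <= c)%E.
Proof.
move=> vc; rewrite limn_einf_lim; apply: lime_le; first exact: is_cvg_einfs.
apply: nearW => r; apply: le_trans (vc r); apply: ereal_inf_lbound.
by exists r => /=.
Qed.

(** Each factor loses c^(1-g) with g = alpha/(mn) in [0,1), and this is at most [c] because c >= 1.
    The bound by [c] is free of [alpha]. *)
Lemma dilation_le {R : realType} (m n : nat) (alpha v v' c : R) (phi phi' : 'I_m -> R) :
  (0 < m)%N -> (0 < n)%N -> 0 <= alpha -> alpha < (m * n)%:R ->
  0 < v -> 0 < v' -> 1 <= c -> v' <= c * v ->
  (forall i, 0 <= phi i <= phi' i) ->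
  \prod_(i < m) ((v `^ (1 - alpha / (m * n)%:R))^-1 * phi i) <=
  c ^+ m * (v' `^ (alpha / n%:R) * \prod_(i < m) (phi' i / v')).
Proof.
move=> m0 n0 a0 amn v0 v'0 c1 v'cv hphi.
have mR : m%:R != 0 :> R by rewrite pnatr_eq0 -lt0n.
have nR : n%:R != 0 :> R by rewrite pnatr_eq0 -lt0n.
have mn0 : 0 < (m * n)%:R :> R by rewrite ltr0n muln_gt0 m0.
have c0 : 0 < c by exact: lt_le_trans c1.
set g := alpha / (m * n)%:R.
have g0 : 0 <= g by rewrite divr_ge0// ltW.
have g1 : g < 1 by rewrite ltr_pdivrMr// mul1r.
have -> : v' `^ (alpha / n%:R) = \prod_(i < m) v' `^ g.
  rewrite prodr_const card_ord -powR_mulrn ?powR_ge0// -powRrM; congr (_ `^ _).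
  by rewrite /g natrM; field; rewrite mR nR.
have -> : c ^+ m = \prod_(i < m) c by rewrite prodr_const card_ord.
rewrite -!big_split/=; apply: ler_prod => i _.
have /andP[p0 pp] := hphi i.
rewrite mulr_ge0 ?invr_ge0 ?powR_ge0//=.
have le1 : (v `^ (1 - g))^-1 <= c * (v' `^ (1 - g))^-1.
  rewrite ler_pdivlMr ?powR_gt0// mulrC ler_pdivrMr ?powR_gt0//.
  apply: (@le_trans _ _ ((c * v) `^ (1 - g))).
    by apply: ge0_ler_powR; rewrite ?nnegrE ?mulr_ge0// ?subr_ge0 ltW.
  rewrite powRM ?(ltW c0) ?(ltW v0)// ler_wpM2r ?powR_ge0//.
  by apply: ler1_powR => //; rewrite lerBlDr lerDl.
apply: (@le_trans _ _ (c * (v' `^ (1 - g))^-1 * phi' i)).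
  by apply: ler_pM; rewrite ?invr_ge0 ?powR_ge0.
rewrite powRB ?(gt_eqF v'0) ?implybT// powRr1 ?(ltW v'0)//.
have vg := powR_gt0 g v'0; move: (v' `^ g) vg => y y0.
rewrite le_eqVlt; apply/orP; left; apply/eqP.
by field; rewrite !gt_eqF.
Qed.

(** A supremum in the extended reals could be -oo, so a cube containing [x] must be exhibited. *)
Lemma maximal_ge0 {R : realType} {n} (g : Rn R n -> R) x : (0 <= maximal g x)%E.
Proof.
pose Q := closed_cube (fun i => tnth x i) 1.
apply: (@le_trans _ _ (average (fun y => `|g y|) Q)).
  apply: mule_ge0; first by rewrite inve_ge0; exact: measure_ge0.
  by apply: integral_ge0 => y _; rewrite lee_fin.
apply: ereal_sup_ubound; exists Q => //; split; first by exists (fun i => tnth x i), 1.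
by move=> i; rewrite lexx/= lerDl.
Qed.

Lemma Ainfty_const_ge0 {R : realType} {n} (g : Rn R n -> R) :
  (forall x, 0 <= g x) -> (0 <= Ainfty_const g)%E.
Proof.
move=> g0; pose Q : set (Rn R n) := closed_cube (fun=> 0) 1.
apply: (@le_trans _ _ ((\int[lebesgue]_(x in Q) (g x)%:E)^-1 *
   \int[lebesgue]_(x in Q) maximal (fun y => g y * \1_Q y)%R x)%E).
  apply: mule_ge0; last by apply: integral_ge0 => x _; exact: maximal_ge0.
  by rewrite inve_ge0; apply: integral_ge0 => x _; rewrite lee_fin.
by apply: ereal_sup_ubound; exists Q => //; exists (fun=> 0), 1.
Qed.

Lemma APq_const_ge0 {R : realType} {m n} (alpha p q : R) (P : 'I_m -> R)
  (u : Rn R n -> R) (w : 'I_m -> Rn R n -> R) : (0 <= APq_const alpha p q P u w)%E.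
Proof.
pose Q : set (Rn R n) := closed_cube (fun=> 0) 1.
apply: (@le_trans _ _ (lebesgue Q `^ (alpha / n%:R + q^-1 - p^-1)%R *
               average u Q `^ (q^-1)%R * \prod_(i < m)
                 average (dual_weight (P i) (w i)) Q `^ ((conjugate (P i))^-1)%R)%E).
  rewrite mule_ge0 ?mule_ge0 ?poweR_ge0//.
  by apply: prode_ge0 => i _; exact: poweR_ge0.
by apply: ereal_sup_ubound; exists Q => //; exists (fun=> 0), 1.
Qed.

(** * The sparse bound for finite constants [K], [X], [N] *)

Section finite_bound.
Context {R : realType} {m n : nat}.
Variables (P : 'I_m -> R) (p q alpha : R) (u : Rn R n -> R) (w f : 'I_m -> Rn R n -> R).
Variables (K : R) (X N : 'I_m -> R).
Hypotheses (m0 : (0 < m)%N) (P1 : forall i, 1 < P i).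
Hypotheses (hp : \sum_(i < m) (P i)^-1 = p^-1) (hpq : p <= q) (p0 : 0 < p).
Hypothesis alpha0 : 0 <= alpha.
Hypotheses (wu : weight u) (ww : forall i, weight (w i)).
Hypothesis w0 : forall i, {ae lebesgue, forall x, 0 < w i x}.
Hypothesis wsigma : forall i, weight (dual_weight (P i) (w i)).
Hypothesis mf : forall i, measurable_fun setT (f i).
Hypothesis KE : APq_const alpha p q P u w = K%:E.
Hypothesis XE : forall i, Ainfty_const (dual_weight (P i) (w i)) = (X i)%:E.
Hypothesis NE : forall i, wnorm (P i) (fun x => w i x `^ P i) (EFin \o f i) = (N i)%:E.

Definition is_half_cube (Q : set (Rn R n)) := exists b s, 0 < s /\ Q = half_cube b s.

Definition vol (Q : set (Rn R n)) : R := fine (lebesgue Q).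

Definition cube_int (g : Rn R n -> R) (Q : set (Rn R n)) : R :=
  fine (\int[lebesgue]_(x in Q) (g x)%:E).

Definition fphi (i : 'I_m) := cube_int (fun x => `|f i x|).

Local Notation sig i := (dual_weight (P i) (w i)).
Local Notation s i := (cube_int (sig i)).
Local Notation beta := (alpha / n%:R).
Local Notation lam := (avg_prod vol fphi beta).

Let P0 i : 0 < P i. Proof. exact: lt_trans (P1 i). Qed.
Let q0 : 0 < q. Proof. exact: lt_le_trans hpq. Qed.

Lemma half_cube_vol Q : is_half_cube Q ->
  [/\ measurable Q, lebesgue Q = (vol Q)%:E & 0 < vol Q].
Proof.
move=> [b [l [l0 ->]]]; have [mh lh] := half_cube_lebesgue b l l0.
by rewrite /vol lh; split => //=; exact: exprn_gt0.
Qed.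

Lemma cube_intE (g : Rn R n -> R) (Q : set (Rn R n)) : (forall x, 0 <= g x) ->
  (\int[lebesgue]_(x in Q) (g x)%:E < +oo)%E ->
  (\int[lebesgue]_(x in Q) (g x)%:E = (cube_int g Q)%:E)%E /\ 0 <= cube_int g Q.
Proof.
move=> g0 gQ; have i0 : (0 <= \int[lebesgue]_(x in Q) (g x)%:E)%E.
  by apply: integral_ge0 => x _; rewrite lee_fin.
have E : (\int[lebesgue]_(x in Q) (g x)%:E = (cube_int g Q)%:E)%E.
  by rewrite /cube_int fineK// ge0_fin_numE.
by split => //; rewrite -lee_fin -E.
Qed.

Lemma weight_half_cube (g : Rn R n -> R) (b : 'I_n -> R) (l : R) : weight g -> 0 < l ->
  (\int[lebesgue]_(x in half_cube b l) (g x)%:E =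
   \int[lebesgue]_(x in closed_cube b l) (g x)%:E)%E.
Proof.
move=> [g0 [mg gi]] l0; apply: half_cube_integral.
- exact: l0.
- exact/measurable_EFinP.
- by move=> x; rewrite lee_fin.
Qed.

Lemma weight_cube_int (g : Rn R n -> R) (Q : set (Rn R n)) : weight g -> is_half_cube Q ->
  (\int[lebesgue]_(x in Q) (g x)%:E = (cube_int g Q)%:E)%E /\ 0 <= cube_int g Q.
Proof.
move=> wg [b [l [l0 ->]]]; have [g0 gl] := wg; apply: cube_intE => //.
by rewrite weight_half_cube//; exact: loc_integrable_cube.
Qed.

Let mw i : measurable_fun setT (w i). Proof. by have [_ []] := ww i. Qed.

Lemma dual_weight_cube_gt0 i Q : is_half_cube Q -> 0 < s i Q.
Proof.
move=> hQ; have [mQ vE v0] := half_cube_vol _ hQ.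
have lQ : (0 < lebesgue Q)%E by rewrite vE lte_fin.
rewrite -lte_fin -(weight_cube_int _ _ (wsigma i) hQ).1.
exact: (integral_dual_power_gt0 lebesgue (P i) (w i) (mw i) (w0 i) Q mQ).
Qed.

Lemma dual_density_norm i :
  (\int[lebesgue]_x (dual_density (P i) (w i) (f i) x `^ P i *
     dual_power (P i) (w i) x)%:E = (N i `^ P i)%:E)%E.
Proof.
rewrite (integral_dual_density_powR lebesgue (P i) (w i) (f i) (P1 i) (mf i) (mw i) (w0 i)).
apply: (wnorm_powR _ _ (fun x => w i x `^ P i)) => //.
by move=> x; exact: powR_ge0.
Qed.

Lemma fphiE i Q : is_half_cube Q ->
  (\int[lebesgue]_(x in Q) `|f i x|%:E = (fphi i Q)%:E)%E /\ 0 <= fphi i Q.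
Proof.
move=> hQ; have [mQ vE v0] := half_cube_vol _ hQ.
apply: cube_intE; first by [].
apply: (integral_dual_density_lty lebesgue (P i) (w i) (f i) (P1 i) (mf i) (mw i) (w0 i) _ mQ).
  by have [-> _] := weight_cube_int _ _ (wsigma i) hQ; rewrite ltry.
by rewrite dual_density_norm ltry.
Qed.

Lemma testing_half_cube Q : is_half_cube Q ->
  lam Q `^ q * cube_int u Q <=
  K `^ q * \prod_(i < m) ((fphi i Q / s i Q) `^ P i * s i Q) `^ (q / P i).
Proof.
move=> hQ; have [mQ vE v0] := half_cube_vol _ hQ.
apply: (testing_cube_powR _ _ p) => //.
- by have [] := weight_cube_int _ _ wu hQ.
- by move=> i; exact: dual_weight_cube_gt0.
- by move=> i; have [] := fphiE i _ hQ.
have [b [l [l0 QE]]] := hQ.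
have [mc lc] := closed_cube_lebesgue b l l0.
have vol_neq0 : vol Q != 0 by rewrite gt_eqF.
have lcE : lebesgue (closed_cube b l) = (vol Q)%:E.
  by rewrite lc -vE QE (half_cube_lebesgue b l l0).2.
have avgE g : weight g -> average g (closed_cube b l) = ((vol Q)^-1 * cube_int g Q)%:E.
  move=> wg; rewrite /average lcE inver (negPf vol_neq0) -weight_half_cube// -QE.
  by have [-> _] := weight_cube_int _ _ wg hQ.
rewrite -lee_fin -KE; apply: ereal_sup_ubound; exists (closed_cube b l).
  by exists b, l.
rewrite lcE !avgE// !poweR_EFin.
under eq_bigr do rewrite avgE// poweR_EFin.
by rewrite prodEFin -!EFinM.
Qed.

Section family.
Variable F : seq (set (Rn R n)).
Hypotheses (lF : laminar F) (hF : forall Q, Q \in F -> is_half_cube Q).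

Local Notation SF := (sparse_family F vol fphi beta).

Let SF_F Q : Q \in SF -> Q \in F.
Proof. by case/mem_sparse. Qed.

(* The average of sigma over Q bounds M(sigma 1_M) from below on the part of Q kept by
   sparse_packing. *)
Lemma sparse_Ainfty_packing i M : M \in F ->
  \sum_(Q <- SF | `[< Q `<=` M >]) s i Q <= 4 * X i * s i M.
Proof.
move=> MF; have hM := hF _ MF; have [b [l [l0 ME]]] := hM.
have [sM sM0] := weight_cube_int _ _ (wsigma i) hM.
have [ws1 [ws2 ws3]] := wsigma i.
have := @sparse_packing _ _ _ _ lebesgue F (fun i x => `|f i x|) vol fphi beta m0 lF
  (fun Q QF => let: And3 h _ _ := half_cube_vol _ (hF _ QF) in h)
  (fun Q QF => let: And3 _ _ h := half_cube_vol _ (hF _ QF) in h)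
  (fun Q QF => let: And3 _ h _ := half_cube_vol _ (hF _ QF) in h).
rewrite -mulrA; apply.
- by move=> j; apply: measurableT_comp (mf j).
- by [].
- by move=> j Q QF; have [] := fphiE j _ (hF _ QF).
- by rewrite divr_ge0.
- by move=> Q QF; have [_] := weight_cube_int _ _ (wsigma i) (hF _ QF).
- by rewrite ME; exact: half_cube_sub.
- move=> x _; exact: (maximal_ge0 (fun y => sig i y * \1_(closed_cube b l) y)).
- move=> Q x QF; have [b' [l' [l'0 QE]]] := hF _ QF.
  rewrite ME => QM Qx.
  have [mQ vE v0] := half_cube_vol _ (hF _ QF).
  have [sQ _] := weight_cube_int _ _ (wsigma i) (hF _ QF).
  by apply: (average_le_maximal _ ws2 ws1 b l b' l') => //; rewrite -QE.
- apply: Ainfty_cube => //; first exact: dual_weight_cube_gt0.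
  by rewrite -weight_half_cube// -ME.
Qed.

Lemma X_ge0 i : 0 <= X i.
Proof. by rewrite -lee_fin -XE; apply: Ainfty_const_ge0 => x; exact: powR_ge0. Qed.

(** The family and its packing constant are left free: the sparse family has constant 4 [X i], while
    a single cube has constant 1 and so gives a bound without A_infty constants. *)
Let carleson_family i (S : seq (set (Rn R n))) (b : R) : laminar S ->
  (forall Q, Q \in S -> is_half_cube Q) -> 0 <= b ->
  (forall M, M \in S -> \sum_(Q <- S | `[< Q `<=` M >]) s i Q <= b * s i M) ->
  \sum_(Q <- S) (fphi i Q / s i Q) `^ P i * s i Q <=
    carleson_const (P i) * b * N i `^ P i.
Proof.
move=> lS hS b0 pack; rewrite -lee_fin [leRHS]EFinM -dual_density_norm.
apply: (@carleson_embedding _ _ _ lebesgue _ _ S (s i) (fphi i) b).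
- exact: measurable_dual_density.
- exact: measurable_dual_power.
- by move=> x; exact: dual_density_ge0.
- by move=> x; exact: dual_power_ge0.
- exact: lS.
- by move=> Q QS; have [] := half_cube_vol _ (hS _ QS).
- by move=> Q QS; exact/dual_weight_cube_gt0/hS.
- by move=> Q QS; have [] := weight_cube_int _ _ (wsigma i) (hS _ QS).
- move=> Q QS; rewrite (integral_dual_density lebesgue (P i) (w i) (f i) (mf i) (mw i) (w0 i)).
    by have [] := fphiE i _ (hS _ QS).
  by have [] := half_cube_vol _ (hS _ QS).
- exact: b0.
- exact: pack.
- exact: P1.
Qed.

(** The Carleson constant enters with exponents (q-p)/P i and p/P i, in total q/P i. The packing
    factor 4 enters only through the second. *)
Definition sparse_const := \prod_(i < m) (carleson_const (P i) `^ (q / P i) * 4 `^ (p / P i)).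

(* Writing a i Q for the i-th Carleson term, prod (a i Q)^(q/P i) is split as a power
   (q-p)/P i, bounded by a single term without the A_infty constants, times a power p/P i,
   summed by Hoelder; this gives the exponent p/q of the A_infty constants. *)
Theorem sparse_sum_le :
  \sum_(Q <- SF) lam Q `^ q * cube_int u Q <=
  sparse_const * (K * \prod_(i < m) X i `^ (p / q * (P i)^-1) * \prod_(i < m) N i) `^ q.
Proof.
pose a i Q := (fphi i Q / s i Q) `^ P i * s i Q.
have hS Q : Q \in SF -> is_half_cube Q by move=> /SF_F /hF.
have lS : laminar SF by move=> A B /SF_F AF /SF_F; exact: lF.
have sgt0 i Q : Q \in SF -> 0 < s i Q by move=> /hS; exact: dual_weight_cube_gt0.
have a0 i Q : Q \in SF -> 0 <= a i Q.
  by move=> QS; rewrite mulr_ge0 ?powR_ge0// ltW// sgt0.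
have cc0 i : 0 <= carleson_const (P i).
  rewrite !mulr_ge0 ?powR_ge0// ltW// geom_const_gt0// subr_gt0//.
have N0 i : 0 <= N i by rewrite -lee_fin -NE; exact: poweR_ge0.
have K0 : 0 <= K by rewrite -lee_fin -KE; exact: APq_const_ge0.
have single i Q : Q \in SF -> a i Q <= carleson_const (P i) * N i `^ P i.
  move=> QS; have := carleson_family i [:: Q] 1; rewrite big_seq1 mulr1; apply => //.
  - by move=> A B; rewrite !mem_seq1 => /eqP -> /eqP ->; left.
  - by move=> B; rewrite mem_seq1 => /eqP ->; exact: hS.
  - move=> M; rewrite mem_seq1 => /eqP ->; rewrite big_mkcond big_seq1 mul1r.
    by case: ifP => // _; rewrite ltW// sgt0.
have total i : \sum_(Q <- SF) a i Q <= carleson_const (P i) * (4 * X i) * N i `^ P i.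
  apply: carleson_family => //; first by rewrite mulr_ge0// X_ge0.
  by move=> M /SF_F MF; exact: sparse_Ainfty_packing.
have pq i : q / P i = (q - p) / P i + p / P i by rewrite -mulrDl subrK.
have nz i : ((q - p) / P i + p / P i == 0) = false.
  by rewrite -pq gt_eqF// divr_gt0.
have le1 Q : Q \in SF -> lam Q `^ q * cube_int u Q <=
    K `^ q * (\prod_(i < m) (carleson_const (P i) * N i `^ P i) `^ ((q - p) / P i) *
      \prod_(i < m) a i Q `^ (p / P i)).
  move=> QS; apply: le_trans (testing_half_cube _ (hS _ QS)) _.
  rewrite ler_wpM2l ?powR_ge0// -big_split/=; apply: ler_prod => i _.
  rewrite powR_ge0/= -/(a i Q) pq powRD ?nz//.
  rewrite ler_wpM2r ?powR_ge0//; apply: ge0_ler_powR; rewrite ?nnegrE.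
  - by rewrite divr_ge0 ?subr_ge0// ltW.
  - exact: a0.
  - by rewrite mulr_ge0 ?powR_ge0.
  - exact: single.
apply: (@le_trans _ _ (K `^ q * (\prod_(i < m) (carleson_const (P i) * N i `^ P i) `^ ((q - p) / P i) *
      \prod_(i < m) (carleson_const (P i) * (4 * X i) * N i `^ P i) `^ (p / P i)))).
  apply: (@le_trans _ _ (K `^ q * (\prod_(i < m) (carleson_const (P i) * N i `^ P i) `^ ((q - p) / P i) *
      \sum_(Q <- SF) \prod_(i < m) a i Q `^ (p / P i)))).
    rewrite !mulr_sumr big_seq [leRHS]big_seq; apply: ler_sum => Q; exact: le1.
  rewrite ler_wpM2l ?powR_ge0// ler_wpM2l ?prodr_ge0// => [i _|]; first exact: powR_ge0.
  apply: hoelder_sum => //.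
  - by move=> i; rewrite divr_gt0.
  - by rewrite -mulr_sumr hp divff// gt_eqF.
have PX0 : 0 <= \prod_(i < m) X i `^ (p / q * (P i)^-1).
  by rewrite prodr_ge0// => i _; exact: powR_ge0.
have PN0 : 0 <= \prod_(i < m) N i by rewrite prodr_ge0.
rewrite powRM ?mulr_ge0// powRM// (powR_prod _ q N0).
rewrite powR_prod => [|i]; last exact: powR_ge0.
rewrite /sparse_const -[X in _ <= _ * X]mulrA [leRHS]mulrCA.
rewrite ler_wpM2l ?powR_ge0// -!big_split/= le_eqVlt; apply/orP; left; apply/eqP.
apply: eq_bigr => i _.
have Pi0 : P i != 0 by rewrite gt_eqF.
have -> : (X i `^ (p / q * (P i)^-1)) `^ q = X i `^ (p / P i).
  by rewrite -powRrM; congr (_ `^ _); field; rewrite Pi0 gt_eqF.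
have -> : N i `^ q = (N i `^ P i) `^ (q / P i).
  by rewrite -powRrM; congr (_ `^ _); field.
have NP0 : 0 <= N i `^ P i by exact: powR_ge0.
have X0 := X_ge0 i; have c0 := cc0 i.
have pqx x : x `^ (q / P i) = x `^ ((q - p) / P i) * x `^ (p / P i).
  by rewrite pq powRD ?nz.
have X40 : 0 <= 4 * X i by rewrite mulr_ge0.
rewrite !pqx (powRM _ c0 NP0) (powRM _ (mulr_ge0 c0 X40) NP0) (powRM _ c0 X40).
rewrite (powRM _ _ X0)//.
move: (carleson_const (P i) `^ ((q - p) / P i)) (carleson_const (P i) `^ (p / P i))
  ((N i `^ P i) `^ ((q - p) / P i)) ((N i `^ P i) `^ (p / P i))
  (4 `^ (p / P i)) (X i `^ (p / P i)) => c1 c2 n1 n2 y x.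
by ring.
Qed.

End family.

(** * From sparse families in the grids to the maximal function *)

Local Notation Sr r t := (sparse_family (grid_family r t) vol fphi beta).
Local Notation a := (@sparse_ratio R m).

(** The factor [a] is the loss in [sparse_dominates]. Suprema over grids and sparse cubes are
    replaced by sums, which yields a measurable function with [u] included. *)
Definition sparse_op (r : nat) (x : Rn R n) : R :=
  (\sum_(t : {ffun 'I_n -> bool}) \sum_(Q <- Sr r t) (a * lam Q) `^ q * \1_Q x) * u x.

Let a0 : 0 < a. Proof. exact: lt_trans (@sparse_ratio_gt1 R m m0). Qed.

Let u0 x : 0 <= u x. Proof. by have [] := wu. Qed.

Let mu_u : measurable_fun setT u. Proof. by have [_ []] := wu. Qed.

Let Sr_hc r (t : {ffun 'I_n -> bool}) Q : Q \in Sr r t -> is_half_cube Q.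
Proof. by case/mem_sparse => /grid_family_cube. Qed.

Lemma sparse_op_ge0 r x : 0 <= sparse_op r x.
Proof.
apply: mulr_ge0 => //; apply: sumr_ge0 => t _; apply: sumr_ge0 => Q _.
by rewrite mulr_ge0 ?powR_ge0.
Qed.

Let sparse_opE r x : (sparse_op r x)%:E = (\sum_(t : {ffun 'I_n -> bool})
  \sum_(Q <- Sr r t) ((a * lam Q) `^ q)%:E * ((EFin \o u) \_ Q) x)%E.
Proof.
rewrite /sparse_op mulr_suml -sumEFin; apply: eq_bigr => t _.
rewrite mulr_suml -sumEFin; apply: eq_bigr => Q _.
rewrite patchE indicE; case: ifPn => _; first by rewrite mulr1 EFinM.
by rewrite mulr0 mul0r mule0.
Qed.

Let restrict_measurable Q : is_half_cube Q ->
  measurable_fun setT ((EFin \o u) \_ Q).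
Proof.
move=> /half_cube_vol[mQ _ _]; apply/(measurable_restrictT _ mQ).1.
by apply/measurable_EFinP; apply: measurable_funTS; exact: mu_u.
Qed.

Let sum_measurable r (t : {ffun 'I_n -> bool}) : measurable_fun setT
  (fun x => \sum_(Q <- Sr r t) ((a * lam Q) `^ q)%:E * ((EFin \o u) \_ Q) x)%E.
Proof.
apply: emeasurable_sum_seq => Q QS; apply: measurable_funeM.
by apply: restrict_measurable; exact: Sr_hc QS.
Qed.

Lemma measurable_sparse_op r : measurable_fun setT (EFin \o sparse_op r).
Proof.
apply: (eq_measurable_fun (fun x => \sum_(t : {ffun 'I_n -> bool})
  \sum_(Q <- Sr r t) ((a * lam Q) `^ q)%:E * ((EFin \o u) \_ Q) x)%E).
  by move=> x _; rewrite -sparse_opE.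
by apply: emeasurable_sum_seq => t _; exact: sum_measurable.
Qed.

Local Notation Z := (K * \prod_(i < m) X i `^ (p / q * (P i)^-1) * \prod_(i < m) N i).

Lemma integral_sparse_op r :
  (\int[lebesgue]_x (sparse_op r x)%:E <=
   ((2 ^ n)%:R * (a `^ q * (sparse_const * Z `^ q)))%:E)%E.
Proof.
have r0 Q x : (0 <= ((EFin \o u) \_ Q) x)%E.
  by apply: erestrict_ge0 => y _; rewrite lee_fin.
under eq_integral do rewrite sparse_opE.
rewrite (ge0_integral_sum_seq lebesgue); last 2 first.
- by move=> t _; exact: sum_measurable.
- by move=> t x _; apply: sume_ge0 => Q _; rewrite mule_ge0// lee_fin powR_ge0.
apply: (@le_trans _ _ (\sum_(t : {ffun 'I_n -> bool}) (a `^ q * (sparse_const * Z `^ q))%:E)%E).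
  apply: lee_sum => t _; rewrite (ge0_integral_sum_seq lebesgue); last 2 first.
  - move=> Q QS; apply: measurable_funeM; apply: restrict_measurable; exact: Sr_hc QS.
  - by move=> Q x _; rewrite mule_ge0// lee_fin powR_ge0.
  have -> : (\sum_(Q <- Sr r t) \int[lebesgue]_x (((a * lam Q) `^ q)%:E * ((EFin \o u) \_ Q) x)
      = (a `^ q * \sum_(Q <- Sr r t) lam Q `^ q * cube_int u Q)%:E)%E.
    rewrite mulr_sumr -sumEFin; apply: eq_big_seq => Q QS.
    have hQ := Sr_hc _ _ _ QS; have [mQ vE v0] := half_cube_vol _ hQ.
    rewrite (ge0_integralZl_EFin lebesgue measurableT); last 3 first.
    - by move=> x _; exact: r0.
    - exact: restrict_measurable.
    - exact: powR_ge0.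
    rewrite -integral_mkcond (weight_cube_int _ _ wu hQ).1 -EFinM mulrA; congr ((_ * _)%:E).
    rewrite powRM// ?(ltW a0)// mulr_ge0 ?powR_ge0// prodr_ge0// => i _.
    by rewrite divr_ge0 ?(ltW v0)//; have [] := fphiE i _ hQ.
  rewrite lee_fin ler_wpM2l ?powR_ge0//; apply: sparse_sum_le.
    exact: grid_family_laminar.
  by move=> Q; exact: grid_family_cube.
by rewrite sumEFin lee_fin sumr_const card_ffun card_bool card_ord mulr_natl.
Qed.

Hypotheses (n0 : (0 < n)%N) (alphamn : alpha < (m * n)%:R).

Local Notation c6 := (((6 ^+ n) ^+ m) `^ q : R).

(** The cube lies in a grid cube [Q] of at most 6 times its side, and [Q] in a sparse set that also
    contains [x], so one term of [sparse_op] suffices. The constant [c6] is the volume ratio 6^n,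
    once per factor, to the power q. *)
Lemma cube_term_le x (b : 'I_n -> R) (l : R) : 0 < l -> closed_cube b l x ->
  exists r0, forall r, (r0 <= r)%N ->
  ((\prod_(i < m) ((lebesgue (closed_cube b l) `^ (1 - alpha / (m * n)%:R)%R)^-1 *
      \int[lebesgue]_(y in closed_cube b l) `|f i y|%:E)) `^ q * (u x)%:E <=
   (c6 * sparse_op r x)%:E)%E.
Proof.
move=> l0 bx; have [r0 Hr0] := grid_cover b l l0; exists r0 => r r0r.
have [t [Q [QF subQ [b' [s' [s'0 s'6 QE]]]]]] := Hr0 r r0r.
have hQ : is_half_cube Q by exists b', s'.
have [mQ vE v0] := half_cube_vol _ hQ.
have [mc lc] := closed_cube_lebesgue b l l0.
have volE : vol Q = s' ^+ n.
  by apply: EFin_inj; rewrite -vE QE (half_cube_lebesgue b' s' s'0).2.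
pose y i := cube_int (fun z => `|f i z|) (closed_cube b l).
have yE i : (\int[lebesgue]_(z in closed_cube b l) `|f i z|%:E = (y i)%:E)%E /\
    0 <= y i <= fphi i Q.
  have le1 : (\int[lebesgue]_(z in closed_cube b l) `|f i z|%:E <= (fphi i Q)%:E)%E.
    rewrite -(fphiE i _ hQ).1; apply: ge0_subset_integral.
    - exact: mc.
    - exact: mQ.
    - by apply/measurable_EFinP/measurable_funTS; exact: measurableT_comp (mf i).
    - by move=> z _; rewrite lee_fin.
    - exact: subQ.
  have [E Y0] := cube_intE (fun z => `|f i z|) (closed_cube b l) (fun z => normr_ge0 _)
    (le_lt_trans le1 (ltry _)).
  by split => //; rewrite Y0/= -lee_fin -E.
have ln0 : 0 < l ^+ n by exact: exprn_gt0.
rewrite lc; under eq_bigr => i _.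
  rewrite (yE i).1 poweR_EFin inver gt_eqF ?powR_gt0// -EFinM; over.
rewrite prodEFin poweR_EFin -EFinM lee_fin.
set V := \prod_(i < m) _.
have V0 : 0 <= V.
  apply: prodr_ge0 => i _; rewrite mulr_ge0 ?invr_ge0 ?powR_ge0//.
  by have [_ /andP[]] := yE i.
have VQ : V <= (6 ^+ n) ^+ m * lam Q.
  apply: dilation_le => //.
  - by rewrite exprn_ege1// ler1n.
  - by rewrite volE -exprMn lerXn2r ?nnegrE ?mulr_ge0// ltW.
  - by move=> i; have [] := yE i.
have c60 : 0 <= (6 ^+ n) ^+ m :> R by rewrite !exprn_ge0.
have lam0 : 0 <= lam Q.
  rewrite mulr_ge0 ?powR_ge0// prodr_ge0// => i _.
  by rewrite divr_ge0 ?(ltW v0)//; have [] := fphiE i _ hQ.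
(* Sparse domination applies only to positive [lam Q]; if it is zero, [V] is zero as well. *)
rewrite le_eqVlt in lam0; case/orP: lam0 => [/eqP l0Q|lamQ].
  have -> : V = 0 by apply/eqP; rewrite eq_le V0 andbT (le_trans VQ)// -l0Q mulr0.
  by rewrite powR0 ?gt_eqF// mul0r mulr_ge0 ?powR_ge0// sparse_op_ge0.
have [M MS [QM QMlam]] := sparse_dominates _ vol fphi beta m0 _ QF lamQ.
have aM0 : 0 <= a * lam M by apply: le_trans QMlam; exact: ltW.
apply: (@le_trans _ _ (c6 * (a * lam M) `^ q * u x)).
  rewrite ler_wpM2r// -powRM//; apply: ge0_ler_powR; rewrite ?nnegrE.
  - exact: ltW.
  - exact: V0.
  - exact: mulr_ge0.
  - by apply: (le_trans VQ); rewrite ler_wpM2l.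
rewrite -mulrA ler_wpM2l ?powR_ge0// /sparse_op ler_wpM2r//.
have inner0 t' : 0 <= \sum_(Q <- Sr r t') (a * lam Q) `^ q * \1_Q x.
  by apply: sumr_ge0 => Q' _; rewrite mulr_ge0 ?powR_ge0.
rewrite (bigD1 t)//=; apply: ler_wpDr; first by apply: sumr_ge0.
rewrite (big_rem M)//=; apply: ler_wpDr.
  by apply: sumr_ge0 => Q' _; rewrite mulr_ge0 ?powR_ge0.
by rewrite indicE mem_set ?mulr1//; apply: QM; exact: subQ.
Qed.

Lemma frac_maximal_ge0 x : (0 <= frac_maximal alpha f x)%E.
Proof.
pose Q := closed_cube (fun i => tnth x i) 1.
apply: (@le_trans _ _ (\prod_(i < m) ((lebesgue Q `^ (1 - alpha / (m * n)%:R)%R)^-1 *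
      \int[lebesgue]_(y in Q) `|f i y|%:E))%E).
  apply: prode_ge0 => i _; apply: mule_ge0; first by rewrite inve_ge0 poweR_ge0.
  by apply: integral_ge0 => y _; rewrite lee_fin.
apply: ereal_sup_ubound; exists Q => //; split; first by exists (fun i => tnth x i), 1.
by move=> i; rewrite lexx/= lerDl.
Qed.

(** The threshold [r0] depends on the cube, and nothing makes the sparse families monotone in [r].
    Each cube is therefore bounded by the limit inferior first, and the supremum is taken
    afterwards, through q-th roots. *)
Lemma frac_maximal_le_limn_einf x :
  (`|frac_maximal alpha f x| `^ q * (u x)%:E <=
   limn_einf (fun r => (c6 * sparse_op r x)%:E))%E.
Proof.
have M0 := frac_maximal_ge0 x; rewrite gee0_abs//.
have c60 : 0 <= c6 by exact: powR_ge0.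
set L := limn_einf _.
have L0 : (0 <= L)%E.
  by apply: (limn_einf_ge _ _ 0) => r _; rewrite lee_fin mulr_ge0// sparse_op_ge0.
(* Where [u] vanishes the left side is 0 even if the maximal function is infinite, since +oo * 0 =
   0. *)
have [ux|ux] := eqVneq (u x) 0; first by rewrite ux mule0.
have ux0 : 0 < u x by rewrite lt_neqAle eq_sym ux u0.
have termL Q : cubes_at x Q ->
    ((\prod_(i < m) ((lebesgue Q `^ (1 - alpha / (m * n)%:R)%R)^-1 *
      \int[lebesgue]_(y in Q) `|f i y|%:E)) `^ q * (u x)%:E <= L)%E.
  move=> [[b [l [l0 ->]]] Qx].
  by have [r0 H] := cube_term_le x b l l0 Qx; exact: limn_einf_ge H.
case: L L0 termL => [z| |]// => [z0 termL|_ _]; last by rewrite leey.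
rewrite lee_fin in z0.
have y0 : 0 <= (z / u x) `^ q^-1 by exact: powR_ge0.
have My : (frac_maximal alpha f x <= ((z / u x) `^ q^-1)%:E)%E.
  apply: ge_ereal_sup => _ [Q Qx <-].
  have := termL Q Qx; set V := (\prod_(i < m) _)%E.
  have : (0 <= V)%E.
    apply: prode_ge0 => i _; apply: mule_ge0; first by rewrite inve_ge0 poweR_ge0.
    by apply: integral_ge0 => y _; rewrite lee_fin.
  case: V => [V| |]// V0; last first.
    by rewrite poweRyr ?gt_eqF// gt0_mulye ?lte_fin// leye_eq.
  rewrite poweR_EFin -EFinM !lee_fin -ler_pdivlMr// => VL.
  rewrite lee_fin in V0.
  have -> : V = (V `^ q) `^ q^-1 by rewrite -powRrM divff ?powRr1// gt_eqF.
  apply: ge0_ler_powR; rewrite ?nnegrE ?powR_ge0 ?invr_ge0//; first exact: ltW.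
  by rewrite divr_ge0// ltW.
move: M0 My; case: (frac_maximal alpha f x) => [M| |]//.
move=> M0 My; rewrite poweR_EFin -EFinM lee_fin -ler_pdivlMr//.
rewrite lee_fin in M0; rewrite lee_fin in My.
have -> : z / u x = ((z / u x) `^ q^-1) `^ q.
  by rewrite -powRrM mulVf ?gt_eqF// powRr1// divr_ge0// ltW.
by apply: ge0_ler_powR; rewrite ?nnegrE//; exact: ltW.
Qed.

(** The q-th root of the accumulated losses: dilation by 6, the number 2^n of grids, the stopping
    ratio [a], and the sparse sum. *)
Definition maximal_const : R :=
  (((6 ^+ n) ^+ m) `^ q * ((2 ^ n)%:R * (a `^ q * sparse_const))) `^ q^-1.

Lemma maximal_const_gt0 : 0 < maximal_const.
Proof.
have cc0 i : 0 < carleson_const (P i).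
  by rewrite !mulr_gt0 ?powR_gt0// geom_const_gt0// subr_gt0.
apply: powR_gt0; rewrite !mulr_gt0 ?powR_gt0 ?exprn_gt0 ?ltr0n ?expn_gt0 ?muln_gt0//.
by apply: prodr_gt0 => i _; rewrite mulr_gt0 ?powR_gt0.
Qed.

(** Fatou's lemma is applied to the measurable [sparse_op] only; the maximal function enters through
    monotonicity of the lower integral. *)
Lemma frac_maximal_wnorm_le :
  (wnorm q u (frac_maximal alpha f) <= (maximal_const * Z)%:E)%E.
Proof.
have N0 i : 0 <= N i by rewrite -lee_fin -NE; exact: poweR_ge0.
have K0 : 0 <= K by rewrite -lee_fin -KE; exact: APq_const_ge0.
have wc0 : 0 <= sparse_const.
  by apply: prodr_ge0 => i _; rewrite mulr_ge0 ?powR_ge0.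
have Z0 : 0 <= Z.
  by rewrite !mulr_ge0 ?prodr_ge0// => i _; exact: powR_ge0.
have c60 : 0 <= c6 by exact: powR_ge0.
have k0 : 0 <= c6 * ((2 ^ n)%:R * (a `^ q * sparse_const)).
  by rewrite !mulr_ge0 ?powR_ge0.
have -> : maximal_const * Z =
    (c6 * ((2 ^ n)%:R * (a `^ q * (sparse_const * Z `^ q)))) `^ q^-1.
  have -> : c6 * ((2 ^ n)%:R * (a `^ q * (sparse_const * Z `^ q))) =
    c6 * ((2 ^ n)%:R * (a `^ q * sparse_const)) * Z `^ q by rewrite -!mulrA.
  rewrite [RHS]powRM ?powR_ge0//; congr (_ * _).
  by rewrite -powRrM divff ?gt_eqF// powRr1.
rewrite -poweR_EFin /wnorm.
have I0 : (0 <= \int[lebesgue]_x (`|frac_maximal alpha f x| `^ q * (u x)%:E))%E.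
  by apply: integral_ge0 => x _; rewrite mule_ge0 ?poweR_ge0 ?lee_fin.
have B0 : 0 <= c6 * ((2 ^ n)%:R * (a `^ q * (sparse_const * Z `^ q))).
  by rewrite !mulr_ge0 ?powR_ge0.
apply: gt0_ler_poweR; rewrite ?in_itv/= ?leey ?andbT ?invr_ge0 ?lee_fin//.
  exact: ltW.
apply: (@le_trans _ _ (\int[lebesgue]_x
    limn_einf (fun r => (c6 * sparse_op r x)%:E))%E).
  apply: ge0_le_lower_integral => x _; last exact: frac_maximal_le_limn_einf.
  by rewrite mule_ge0 ?poweR_ge0 ?lee_fin.
have G0 r x : (0 <= (c6 * sparse_op r x)%:E)%E.
  by rewrite lee_fin mulr_ge0// sparse_op_ge0.
apply: le_trans (fatou lebesgue measurableT _ (fun r x _ => G0 r x)) _.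
  move=> r; apply/measurable_EFinP; apply: measurable_funM.
    exact: measurable_cst.
  by apply/measurable_EFinP; exact: measurable_sparse_op.
apply: limn_einf_le => r; under eq_integral do rewrite EFinM.
rewrite (ge0_integralZl_EFin lebesgue measurableT); last 3 first.
- by move=> x _; rewrite lee_fin sparse_op_ge0.
- exact: measurable_sparse_op.
- exact: c60.
rewrite [leRHS]EFinM; apply: lee_wpmul2l; first by rewrite lee_fin.
exact: integral_sparse_op.
Qed.

End finite_bound.

Theorem theorem1p4 (R : realType) (m n : nat) (P : 'I_m -> R) (p q : R)
    (hm : (1 <= m)%N) (hn : (1 <= n)%N)
    (hP : forall i, 1 < P i) (hp : \sum_(i < m) (P i)^-1 = p^-1)
    (hpq : p <= q) :
  exists C : R, 0 < C /\
  forall (alpha : R) (u : Rn R n -> R) (w : 'I_m -> Rn R n -> R),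
    0 <= alpha -> alpha < (m * n)%:R ->
    weight u -> (forall i, weight (w i)) ->
    (forall i, {ae lebesgue, forall x, 0 < w i x}) ->
    (forall i, Ainfty (dual_weight (P i) (w i))) ->
    (APq_const alpha p q P u w < +oo)%E ->
    forall f : 'I_m -> Rn R n -> R,
      (forall i, wLp (P i) (fun x => w i x `^ P i) (f i)) ->
      (wnorm q u (frac_maximal alpha f) <=
        C%:E *
        (APq_const alpha p q P u w *
         \prod_(i < m)
           Ainfty_const (dual_weight (P i) (w i)) `^ (p / q * (P i)^-1)%R) *
        \prod_(i < m) wnorm (P i) (fun x => (w i x `^ P i)%R) (EFin \o f i))%E.
Proof.
(* The sum of the 1/P i is positive because m >= 1 makes it nonempty. *)
have p0 : 0 < p.
  rewrite -invr_gt0 -hp (bigD1 (Ordinal hm))//=; apply: ltr_wpDr.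
    by apply: sumr_ge0 => i _; rewrite invr_ge0 ltW// (lt_trans _ (hP i)).
  by rewrite invr_gt0 (lt_trans _ (hP _)).
(* Formed from m, n, P, p and q alone, with p determined by P, before [alpha] and the weights are
   introduced. *)
exists (@maximal_const R m n P p q); split.
  exact: maximal_const_gt0.
move=> alpha u w a0 amn wu ww w0 Aw Ku f Hf.
have [sw Xoo] : (forall i, weight (dual_weight (P i) (w i))) /\
    (forall i, Ainfty_const (dual_weight (P i) (w i)) < +oo)%E.
  by split => i; have [] := Aw i.
have KE : APq_const alpha p q P u w = (fine (APq_const alpha p q P u w))%:E.
  by rewrite fineK// ge0_fin_numE// APq_const_ge0.
have XE i : Ainfty_const (dual_weight (P i) (w i)) =
    (fine (Ainfty_const (dual_weight (P i) (w i))))%:E.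
  rewrite fineK// ge0_fin_numE//; apply: Ainfty_const_ge0 => x; exact: powR_ge0.
have NE i : wnorm (P i) (fun x => w i x `^ P i) (EFin \o f i) =
    (fine (wnorm (P i) (fun x => w i x `^ P i) (EFin \o f i)))%:E.
  by rewrite fineK// ge0_fin_numE ?poweR_ge0//; have [] := Hf i.
have mf i : measurable_fun setT (f i) by have [] := Hf i.
apply: (le_trans (@frac_maximal_wnorm_le R m n P p q alpha u w f _ _ _
  hm hP hp hpq p0 a0 wu ww w0 sw mf KE XE NE hn amn)).
rewrite EFinM -muleA; apply: lee_wpmul2l; first by rewrite lee_fin ltW// maximal_const_gt0.
rewrite !EFinM -KE -!prodEFin.
rewrite (eq_bigr (fun i => Ainfty_const (dual_weight (P i) (w i)) `^ (p / q * (P i)^-1)%R)%E) => [|i _]; last first.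
  by rewrite -poweR_EFin -XE.
by rewrite [X in (_ * X <= _)%E](eq_bigr _ (fun i _ => esym (NE i))).
Qed.
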